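(* Let $\mathcal A$ be a surjective Banach operator ideal such that $\mathcal A\subset\mathcal A^{dual\ dual}$ and let $X$ be a Banach space. If $X^*$ has the $\mathcal A$-AP, then $X$ has the weak MAP for $\mathcal A^{dual}$.
   Context: All Banach spaces are over the same field, real or complex. $\mathcal F(X;Y)$ denotes the finite rank bounded operators, $\mathcal F(X)=\mathcal F(X;X)$. For a Banach operator ideal $(\mathcal A,\|\cdot\|_{\mathcal A})$: $T\in\mathcal A^{dual}(X;Y)$ iff $T^*\in\mathcal A(Y^*;X^* )$, with $\|T\|_{\mathcal A^{dual}}=\|T^*\|_{\mathcal A}$; $\mathcal A^{dual\ dual}=(\mathcal A^{dual})^{dual}$. Inclusion $\mathcal A\subset\mathcal B$ means $\mathcal A(X;Y)\subset\mathcal B(X;Y)$ for all Banach spaces $X,Y$. $\mathcal A$ is surjective if for every metric surjection (quotient map) $Q\colon Z\to X$ and every bounded operator $T\colon X\to Y$ with $TQ\in\mathcal A(Z;Y)$ one has $T\in\mathcal A(X;Y)$ and $\|T\|_{\mathcal A}=\|TQ\|_{\mathcal A}$. A Banach space $E$ has the $\mathcal A$-approximation property ($\mathcal A$-AP) if $\mathcal F(Y;E)$ is $\|\cdot\|_{\mathcal A}$-dense in $\mathcal A(Y;E)$ for every Banach space $Y$. For a Banach operator ideal $\mathcal B$, $X$ has the weak MAP for $\mathcal B$ if for every Banach space $Y$ and each $T\in\mathcal B(X;Y)$ there is a net $(S_\alpha)$ in $\mathcal F(X)$ such that $S_\alpha\to I_X$ pointwise and $\limsup_\alpha\|TS_\alpha\|_{\mathcal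 B}\le\|T\|_{\mathcal B}$. *)

(* Defs.v *)
From HB Require Import structures.
From mathcomp Require Import all_boot all_order all_algebra.
From mathcomp Require Import complex.
From mathcomp Require Import all_classical all_reals all_analysis.
From mathcomp Require Import ring.
Set Implicit Arguments.
Unset Strict Implicit.
Unset Printing Implicit Defensive.
Import Order.TTheory GRing.Theory Num.Theory.
Import numFieldNormedType.Exports.
Local Open Scope classical_set_scope.
Local Open Scope ring_scope.

Variant scalar_kind := RealScalars | ComplexScalars.

Definition scalars (R : realType) (k : scalar_kind) : numFieldType :=
  match k with
  | RealScalars => R
  | ComplexScalars => R[i]%C
  end.

Section ScalarConversions.
Context {R : realType} {k : scalar_kind}.
Notation K := (scalars R k).

Definition scalar_of_real : R -> K :=
  match k return R -> scalars R k with
  | RealScalars => id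
  | ComplexScalars => real_complex R
  end.

Definition real_part : K -> R :=
  match k return scalars R k -> R with
  | RealScalars => id
  | ComplexScalars => @complex.Re R
  end.

Lemma scalar_of_realK : cancel scalar_of_real real_part.
Proof. by rewrite /scalar_of_real /real_part; case: k. Qed.

Lemma scalar_of_real0 : scalar_of_real 0 = 0.
Proof. by rewrite /scalar_of_real; case: k. Qed.

Lemma scalar_of_real1 : scalar_of_real 1 = 1.
Proof. by rewrite /scalar_of_real; case: k. Qed.

Lemma ler_scalar_of_real a b : (scalar_of_real a <= scalar_of_real b) = (a <= b).
Proof. by rewrite /scalar_of_real; case: k => //=; rewrite lecR. Qed.

Lemma ge0_real_partK (x : K) : 0 <= x -> scalar_of_real (real_part x) = x.
Proof.
rewrite /scalar_of_real /real_part; move: x; case: k => //= x.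
by rewrite complex.lecE /= => /andP[/eqP]; case: x => a b /= ->.
Qed.

End ScalarConversions.

Section ScalarComplete.
Variable R : realType.

Lemma complex_complete (F : set_system (R[i]%C)^o) :
  ProperFilter F -> cauchy F -> cvg F.
Proof.
move=> FF /(cauchyP F) Fc.
have geRe (z : R[i]%C) : (`|complex.Re z|%:C)%C <= `|z| := normc_ge_Re z.
have geIm (z : R[i]%C) : (`|complex.Im z|%:C)%C <= `|z|.
  by case: z => a b; simpc; rewrite -sqrtr_sqr ler_wsqrtr // lerDr sqr_ge0.
have normle (a b : R) : `|(a +i* b)%C : R[i]%C| <= ((`|a| + `|b|)%:C)%C.
  rewrite (_ : (a +i* b)%C = (a%:C + 'i * b%:C)%C); last by simpc.
  rewrite (le_trans (ler_normD _ _))// normrM.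
  rewrite (_ : `|'i%C : R[i]%C| = 1) ?mul1r; last first.
    by rewrite normc_def /= expr0n /= add0r expr1n sqrtr1.
  by rewrite !normc_def /= expr0n /= !addr0 !sqrtr_sqr -rmorphD.
have cRe : cauchy ((fun z : (R[i]%C)^o => complex.Re z : R^o) @ F).
  apply/cauchyP => e e0; have [|z Fz] := Fc (e%:C)%C; first by rewrite ltcR.
  exists (complex.Re z); apply: (@filterS _ F _ (ball z (e%:C)%C) _ _ Fz) => w zw; have {}zw : `|(z : R[i]%C) - w| < (e%:C)%C by exact: zw.
  suff : `|complex.Re z - complex.Re w| < e by []; rewrite -(ltcR (R:=R)); apply: le_lt_trans zw.
  by rewrite -raddfB; exact: geRe.
have cIm : cauchy ((fun z : (R[i]%C)^o => complex.Im z : R^o) @ F).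
  apply/cauchyP => e e0; have [|z Fz] := Fc (e%:C)%C; first by rewrite ltcR.
  exists (complex.Im z); apply: (@filterS _ F _ (ball z (e%:C)%C) _ _ Fz) => w zw; have {}zw : `|(z : R[i]%C) - w| < (e%:C)%C by exact: zw.
  suff : `|complex.Im z - complex.Im w| < e by []; rewrite -(ltcR (R:=R)); apply: le_lt_trans zw.
  by rewrite -raddfB; exact: geIm.
have /cvg_ex[a Fa] := R_complete (fmap_proper_filter _ FF) cRe.
have /cvg_ex[b Fb] := R_complete (fmap_proper_filter _ FF) cIm.
apply/cvg_ex; exists (a +i* b)%C.
apply/(@fcvgrPdist_lt _ (R[i]%C)^o) => e e0.
have eE : e = ((complex.Re e)%:C)%C by apply/esym; apply: (@ge0_real_partK R ComplexScalars); exact: ltW.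
have e20 : 0 < complex.Re e / 2 by rewrite divr_gt0// -(ltcR (R:=R)) -eE.
move/cvgrPdist_lt: Fa => /(_ _ e20) Fa; move/cvgrPdist_lt: Fb => /(_ _ e20) Fb.
near=> z.
have -> : (a +i* b)%C - z = ((a - complex.Re z) +i* (b - complex.Im z))%C.
  by clear; case: z => c d /=; simpc.
rewrite eE.
apply: le_lt_trans (normle _ _) _; rewrite ltcR [ltRHS]splitr ltrD//.
  by near: z.
by near: z.
Unshelve. all: by end_near. Qed.

Lemma scalars_complete k (F : set_system (scalars R k)^o) :
  ProperFilter F -> cauchy F -> cvg F.
Proof. by case: k F => F; [exact: R_complete | exact: complex_complete]. Qed.
End ScalarComplete.

(* The scalar field as a Banach space over itself; an alias is needed because
   [_^o] already carries a [Complete] instance that only covers [realType]. *)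
Definition scalar_space (R : realType) (k : scalar_kind) : Type :=
  (scalars R k)^o.
HB.instance Definition _ R k :=
  NormedModule.copy (scalar_space R k) (scalars R k)^o.
HB.instance Definition _ R k :=
  Uniform_isComplete.Build (scalar_space R k) (@scalars_complete R k).

Section BoundedOperators.
Variables (K : numFieldType) (X Y : normedModType K).

Definition bounded_linear (f : X -> Y) : Prop :=
  linear f /\ exists M : K, forall x, `|f x| <= M * `|x|.

Record bop := Bop { bop_fun :> X -> Y; bopP : `[< bounded_linear bop_fun >] }.

HB.instance Definition _ := [isSub for bop_fun].
HB.instance Definition _ := [Choice of bop by <:].

Lemma bounded_linear_submod :
  subsemimod_closed (fun f : X -> Y => `[< bounded_linear f >]).
Proof.
split; [split|].
- apply/asboolP; split; first by move=> a u v; rewrite scaler0 addr0.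
  by exists 0 => x; rewrite normr0 mul0r.
- move=> f g /asboolP[lf [M fM]] /asboolP[lg [N gN]]; apply/asboolP; split.
    move=> a u v; rewrite !addrfctE lf lg scalerDr.
    by rewrite addrACA.
  exists (M + N) => x; rewrite addrfctE mulrDl.
  by rewrite (le_trans (ler_normD _ _))// lerD.
- move=> a f /asboolP[lf [M fM]]; apply/asboolP; split.
    move=> b u v; rewrite !scalrfctE lf scalerDr !scalerA.
    by rewrite mulrC.
  by exists (`|a| * M) => x; rewrite scalrfctE normrZ -mulrA ler_wpM2l.
Qed.

HB.instance Definition _ :=
  GRing.SubChoice_isSubLmodule.Build K (X -> Y) _ bop bounded_linear_submod.

Lemma bop_linear (f : bop) : linear f.
Proof. exact: (asboolW (bopP f)).1. Qed.

HB.instance Definition _ (f : bop) :=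
  GRing.isLinear.Build K X Y _ (bop_fun f) (bop_linear f).

Lemma bop_bounded (f : bop) : exists2 M : K, 0 <= M &
  forall x, `|f x| <= M * `|x|.
Proof.
have [_ [M fM]] := asboolW (bopP f).
exists `|M|; first exact: normr_ge0.
move=> x; have Mx0 : 0 <= M * `|x| by exact: le_trans (fM x).
by rewrite -[`|x|]normr_id -normrM ger0_norm.
Qed.
End BoundedOperators.

Section BoundedOperatorNorm.
Context {R : realType} {k : scalar_kind}.
Notation K := (scalars R k).

(* The norm [`|x|] of a normed module takes its values in [K], hence formally
   in [R[i]] for complex scalars; [rnorm] is the same norm with values in [R]. *)
Definition rnorm (V : normedModType K) (x : V) : R := real_part `|x|.

Lemma rnormE (V : normedModType K) (x : V) : scalar_of_real (rnorm x) = `|x|.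
Proof. by rewrite ge0_real_partK. Qed.

Lemma rnorm_ge0 (V : normedModType K) (x : V) : 0 <= rnorm x.
Proof. by rewrite -(@ler_scalar_of_real R k) rnormE scalar_of_real0. Qed.

Variables X Y : normedModType K.

Definition opnorm (f : bop X Y) : R :=
  sup [set rnorm (f x) | x in [set x : X | rnorm x <= 1]].

Lemma has_sup_opnorm (f : bop X Y) :
  has_sup [set rnorm (f x) | x in [set x : X | rnorm x <= 1]].
Proof.
split.
  exists (rnorm (f 0)), 0 => //=.
  by rewrite -(@ler_scalar_of_real R k) rnormE normr0 -(@scalar_of_real0 R k)
    ler_scalar_of_real.
have [M M0 fM] := bop_bounded f.
exists (real_part M) => _ [x /= x1 <-].
rewrite -(@ler_scalar_of_real R k) rnormE ge0_real_partK//.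
rewrite (le_trans (fM x))// ler_piMr//.
by move: x1; rewrite -(@ler_scalar_of_real R k) rnormE scalar_of_real1.
Qed.

Lemma opnorm_ge0 (f : bop X Y) : 0 <= scalar_of_real (opnorm f) :> K.
Proof.
rewrite -(@scalar_of_real0 R k) ler_scalar_of_real.
apply: le_trans (rnorm_ge0 (f 0)) _.
apply: (sup_upper_bound (has_sup_opnorm f)); exists 0 => //=.
by rewrite -(@ler_scalar_of_real R k) rnormE normr0 -(@scalar_of_real0 R k)
  ler_scalar_of_real.
Qed.

Lemma bop_norm_subproof (f : bop X Y) (x : X) :
  `|f x| <= scalar_of_real (opnorm f) * `|x|.
Proof.
have [->|x0] := eqVneq x 0; first by rewrite linear0 !normr0 mulr0.
have nx0 : 0 < `|x| by rewrite normr_gt0.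
rewrite -ler_pdivrMr// mulrC.
have -> : `|x|^-1 * `|f x| = `|f (`|x|^-1 *: x)|.
  by rewrite linearZ normrZ [in RHS]ger0_norm// invr_ge0.
rewrite -rnormE ler_scalar_of_real.
apply: (sup_upper_bound (has_sup_opnorm f)).
exists (`|x|^-1 *: x) => //=.
by rewrite -(@ler_scalar_of_real R k) rnormE normfZV// scalar_of_real1.
Qed.

Lemma bop_norm_le_subproof (f : bop X Y) (M : K) : 0 <= M ->
  (forall x, `|f x| <= M * `|x|) -> scalar_of_real (opnorm f) <= M.
Proof.
move=> M0 fM; rewrite -[leRHS]ge0_real_partK// ler_scalar_of_real.
apply: ge_sup; first by have [] := has_sup_opnorm f.
move=> _ [x /= x1 <-].
rewrite -(@ler_scalar_of_real R k) rnormE ge0_real_partK//.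
rewrite (le_trans (fM x))// ler_piMr//.
by move: x1; rewrite -(@ler_scalar_of_real R k) rnormE scalar_of_real1.
Qed.

Lemma opnormD_subproof (f g : bop X Y) :
  scalar_of_real (opnorm (f + g)) <=
  scalar_of_real (opnorm f) + scalar_of_real (opnorm g) :> K.
Proof.
apply: bop_norm_le_subproof => [|x]; first by rewrite addr_ge0 ?opnorm_ge0.
by rewrite mulrDl (le_trans (ler_normD _ _))// lerD// bop_norm_subproof.
Qed.

Lemma opnormZ_subproof (a : K) (f : bop X Y) :
  scalar_of_real (opnorm (a *: f)) = `|a| * scalar_of_real (opnorm f).
Proof.
have le a0 g : scalar_of_real (opnorm (a0 *: g)) <=
    `|a0| * scalar_of_real (opnorm g) :> K.
  apply: bop_norm_le_subproof => [|x]; first by rewrite mulr_ge0 ?opnorm_ge0.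
  rewrite [(a0 *: g) x](_ : _ = a0 *: g x)// normrZ -mulrA ler_wpM2l//.
  exact: bop_norm_subproof.
apply/eqP; rewrite eq_le le /=.
have [->|a0] := eqVneq a 0; first by rewrite normr0 mul0r opnorm_ge0.
by rewrite -ler_pdivlMl ?normr_gt0// -normfV -{1}[f](scalerK a0) le.
Qed.

Lemma opnorm0_eq0_subproof (f : bop X Y) :
  scalar_of_real (opnorm f) = 0 :> K -> f = 0.
Proof.
move=> f0; apply/val_inj/funext => x; apply/eqP; rewrite -normr_le0.
by have := bop_norm_subproof f x; rewrite f0 mul0r.
Qed.

HB.instance Definition _ := Lmodule_isNormed.Build K (bop X Y)
  opnormD_subproof opnormZ_subproof opnorm0_eq0_subproof.

Lemma bop_normE (f : bop X Y) : `|f| = scalar_of_real (opnorm f).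
Proof. by []. Qed.

Lemma ler_bop_norm (f : bop X Y) (x : X) : `|f x| <= `|f| * `|x|.
Proof. exact: bop_norm_subproof. Qed.

Lemma bop_norm_le (f : bop X Y) (M : K) : 0 <= M ->
  (forall x, `|f x| <= M * `|x|) -> `|f| <= M.
Proof. exact: bop_norm_le_subproof. Qed.
End BoundedOperatorNorm.

Section BoundedOperatorComplete.
Context {R : realType} {k : scalar_kind}.
Notation K := (scalars R k).
Variables (X : normedModType K) (Y : completeNormedModType K).

Lemma bop_complete (F : set_system (bop X Y)) :
  ProperFilter F -> cauchy F -> cvg F.
Proof.
move=> FF Fc; have /(cauchyP F) Fex := Fc.
have Fball e : 0 < e -> exists f0, F [set f : bop X Y | `|f0 - f| < e].
  by move=> /Fex[f0 Ff0]; exists f0; move: Ff0; rewrite -ball_normE.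
have cx x : cvg ((fun f : bop X Y => f x) @ F).
  apply: cauchy_cvg; apply/cauchyP => e e0.
  have x1 : 0 < `|x| + 1 by rewrite ltr_wpDl.
  have [|f0 Ff0] := Fball (e / (`|x| + 1)); first by rewrite divr_gt0.
  exists (f0 x); rewrite -ball_normE /=.
  apply: (@filterS _ F _ _ _ _ Ff0) => f /= f0f.
  have -> : f0 x - f x = (f0 - f) x by [].
  apply: le_lt_trans (ler_bop_norm _ _) _.
  have [->|x0] := eqVneq x 0; first by rewrite normr0 mulr0.
  rewrite -lter_pdivlMr ?normr_gt0//; apply: lt_le_trans f0f _.
  by rewrite ler_pM2l// lef_pV2 ?posrE ?normr_gt0// lerDl.
have /choice[g Fg] : forall x, exists y : Y, (fun f : bop X Y => f x) @ F --> y.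
  by move=> x; apply/cvg_ex; exact: cx.
have Fle e : 0 < e -> exists f0, F [set f : bop X Y | `|f0 - f| < e] /\
    forall x, `|g x - f0 x| <= e * `|x|.
  move=> e0; have [f0 Ff0] := Fball _ e0; exists f0; split=> // x.
  rewrite distrC; have cf0 : (fun f : bop X Y => f0 x - f x) @ F --> f0 x - g x.
    by apply: cvgB (Fg x); exact: cvg_cst.
  apply/ler_addgt0Pr => d d0.
  have [f [/= ff0 fd]] : exists f : bop X Y, `|f0 - f| < e /\
      `|(f0 x - g x) - (f0 x - f x)| < d.
    have : F ([set f : bop X Y | `|f0 - f| < e] `&`
        [set f : bop X Y | `|(f0 x - g x) - (f0 x - f x)| < d]).
      apply: filterI => //; move/cvgrPdist_lt: cf0 => /(_ d d0); exact.
    by move=> /filter_ex[f [? ?]]; exists f.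
  rewrite -[f0 x - g x](subrK (f0 x - f x)) addrC.
  apply: le_trans (ler_normD _ _) _; apply: lerD; last exact: ltW.
  have -> : f0 x - f x = (f0 - f) x by [].
  by apply: le_trans (ler_bop_norm _ _) _; rewrite ler_wpM2r// ltW.
have glin : linear g.
  move=> a u v; apply: (@cvg_unique Y _ ((fun f : bop X Y => f (a *: u + v)) @ F)).
  - exact: norm_hausdorff.
  - exact: Fg.
  - have -> : (fun f : bop X Y => f (a *: u + v)) = (fun f => a *: f u + f v).
      by apply/funext => f; rewrite linearP.
    by apply: cvgD (Fg v); apply: cvgZl_tmp; exact: Fg.
have gbl : `[< bounded_linear g >].
  apply/asboolP; split=> //; have [f0 [_ gf0]] := Fle 1 ltr01.
  exists (1 + `|f0|) => x; rewrite mulrDl -[g x](subrK (f0 x)).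
  by apply: le_trans (ler_normD _ _) _; rewrite lerD// ler_bop_norm.
apply/cvg_ex; exists (Bop gbl); apply/fcvgrPdist_lt => e e0.
have e30 : 0 < e / 3 by rewrite divr_gt0.
have [f0 [Ff0 gf0]] := Fle _ e30.
apply: filterS Ff0 => f /= f0f.
rewrite -[Bop gbl - f](subrKA f0).
apply: le_lt_trans (ler_normD _ _) _.
have -> : e = e / 3 + (e / 3 + e / 3) by field.
apply: ler_ltD; first by apply: bop_norm_le => [|x]; [exact: ltW|exact: gf0].
by apply: lt_trans f0f _; rewrite ltrDl.
Qed.

HB.instance Definition _ := Uniform_isComplete.Build (bop X Y) bop_complete.
End BoundedOperatorComplete.

Section BanachSpaces.
Context {R : realType} {k : scalar_kind}.
Notation K := (scalars R k).
Notation banach := (completeNormedModType K).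

Definition dual (X : banach) : banach := bop X (scalar_space R k).

Lemma bounded_linear_id (X : banach) : `[< bounded_linear (@idfun X) >].
Proof.
by apply/asboolP; split=> [a u v //|]; exists 1 => x; rewrite mul1r.
Qed.

Definition bop_id (X : banach) : bop X X := Bop (bounded_linear_id X).

Lemma bounded_linear_comp (X Y Z : banach) (g : bop Y Z) (f : bop X Y) :
  `[< bounded_linear (g \o f) >].
Proof.
apply/asboolP; split=> [a u v /=|]; first by rewrite !linearP.
exists (`|g| * `|f|) => x /=; apply: le_trans (ler_bop_norm _ _) _.
by rewrite -mulrA ler_wpM2l// ler_bop_norm.
Qed.

Definition bop_comp (X Y Z : banach) (g : bop Y Z) (f : bop X Y) : bop X Z :=
  Bop (bounded_linear_comp g f).

Lemma bounded_linear_adjoint (X Y : banach) (T : bop X Y) :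
  `[< bounded_linear (fun g : dual Y => bop_comp g T : dual X) >].
Proof.
apply/asboolP; split=> [a g h|]; first exact/val_inj/funext.
exists `|T| => g; apply: bop_norm_le => [|x]; first by rewrite mulr_ge0.
apply: (@le_trans _ _ (`|g| * `|T x|)); first exact: (@ler_bop_norm R k Y (scalar_space R k)).
by rewrite [`|T| * `|g|]mulrC -mulrA ler_wpM2l// ler_bop_norm.
Qed.

Definition adjoint (X Y : banach) (T : bop X Y) : bop (dual Y) (dual X) :=
  Bop (bounded_linear_adjoint T).

Definition finite_rank (X Y : banach) (T : bop X Y) : Prop :=
  exists (n : nat) (y : 'I_n -> Y),
    forall x, exists c : 'I_n -> K, T x = \sum_(i < n) c i *: y i.

(* [Q] is surjective and the norm of [X] is the quotient norm induced by [Q]. *)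
Definition metric_surjection (Z X : banach) (Q : bop Z X) : Prop :=
  (forall x, exists z, Q z = x) /\
  (forall x, rnorm x = inf [set rnorm z | z in [set z | Q z = x]]).

End BanachSpaces.

Section OperatorIdeals.
Variables (R : realType) (k : scalar_kind).
Notation K := (scalars R k).
Notation banach := (completeNormedModType K).

(* The data of an operator ideal: its components [A(X;Y)] and its norm, whose
   values outside the components are irrelevant. *)
Record ideal_data := IdealData {
  in_ideal : forall X Y : banach, bop X Y -> Prop;
  ideal_norm : forall X Y : banach, bop X Y -> R
}.

(* Pietsch's axioms. *)
Record banach_operator_ideal (A : ideal_data) : Prop := BanachOperatorIdeal {
  ideal_scalar_id : in_ideal A (bop_id (scalar_space R k));
  ideal_norm_scalar_id : ideal_norm A (bop_id (scalar_space R k)) = 1;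
  ideal0 : forall X Y : banach, in_ideal A (0 : bop X Y);
  idealD : forall (X Y : banach) (S T : bop X Y),
    in_ideal A S -> in_ideal A T -> in_ideal A (S + T);
  idealZ : forall (X Y : banach) (a : K) (T : bop X Y),
    in_ideal A T -> in_ideal A (a *: T);
  ideal_normD : forall (X Y : banach) (S T : bop X Y),
    in_ideal A S -> in_ideal A T ->
    ideal_norm A (S + T) <= ideal_norm A S + ideal_norm A T;
  ideal_normZ : forall (X Y : banach) (a : K) (T : bop X Y),
    in_ideal A T -> ideal_norm A (a *: T) = real_part `|a| * ideal_norm A T;
  ideal_norm_eq0 : forall (X Y : banach) (T : bop X Y),
    in_ideal A T -> ideal_norm A T = 0 -> T = 0;
  ideal_complete : forall (X Y : banach) (T : nat -> bop X Y),
    (forall n, in_ideal A (T n)) ->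
    (forall e : R, 0 < e -> exists N : nat, forall m n : nat,
       (N <= m)%N -> (N <= n)%N -> ideal_norm A (T m - T n) < e) ->
    exists2 T0 : bop X Y, in_ideal A T0 &
      forall e : R, 0 < e -> exists N : nat, forall n : nat,
        (N <= n)%N -> ideal_norm A (T n - T0) < e;
  ideal_comp : forall (W X Y Z : banach)
      (P : bop Y Z) (T : bop X Y) (S : bop W X),
    in_ideal A T -> in_ideal A (bop_comp P (bop_comp T S));
  ideal_norm_comp : forall (W X Y Z : banach)
      (P : bop Y Z) (T : bop X Y) (S : bop W X),
    in_ideal A T ->
    ideal_norm A (bop_comp P (bop_comp T S)) <=
      opnorm P * ideal_norm A T * opnorm S
}.

Definition dual_ideal (A : ideal_data) : ideal_data := {|
  in_ideal := fun X Y T => in_ideal A (adjoint T);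
  ideal_norm := fun X Y T => ideal_norm A (adjoint T)
|}.

Definition ideal_incl (A B : ideal_data) : Prop :=
  forall (X Y : banach) (T : bop X Y), in_ideal A T -> in_ideal B T.

Definition surjective_ideal (A : ideal_data) : Prop :=
  forall (X Y Z : banach) (Q : bop Z X) (T : bop X Y),
    metric_surjection Q -> in_ideal A (bop_comp T Q) ->
    in_ideal A T /\ ideal_norm A T = ideal_norm A (bop_comp T Q).

Definition approximation_property (A : ideal_data) (E : banach) : Prop :=
  forall (Y : banach) (T : bop Y E), in_ideal A T ->
    forall e : R, 0 < e ->
      exists2 S : bop Y E, finite_rank S & ideal_norm A (T - S) < e.

Record directed (I : Type) (le : I -> I -> Prop) : Prop := Directed {
  directed_inhabited : exists i : I, True;
  directed_refl : forall i, le i i;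
  directed_trans : forall i j l, le i j -> le j l -> le i l;
  directed_ub : forall i j, exists l, le i l /\ le j l
}.

Definition net_filter (I : Type) (le : I -> I -> Prop) : set_system I :=
  [set P | exists i, forall j, le i j -> P j].

Definition net_limsup (I : Type) (le : I -> I -> Prop) (u : I -> \bar R) :
    \bar R :=
  ereal_inf [set ereal_sup [set u j | j in [set j | le i j]] | i in [set: I]].

Definition weak_MAP (X : banach) (B : ideal_data) : Prop :=
  forall (Y : banach) (T : bop X Y), in_ideal B T ->
    exists (I : Type) (le : I -> I -> Prop) (S : I -> bop X X),
      [/\ directed le,
          forall i, finite_rank (S i),
          forall x : X, S i x @[i --> net_filter le] --> x &
          (net_limsup le (fun i => (ideal_norm B (bop_comp T (S i)))%:E)
             <= (ideal_norm B T)%:E)%E].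

End OperatorIdeals.

(* Main.v *)
Require Import Defs.
From HB Require Import structures.
From mathcomp Require Import all_boot all_order all_algebra.
From mathcomp Require Import complex.
From mathcomp Require Import all_classical all_reals all_analysis.
From mathcomp Require Import ring lra.
Set Implicit Arguments.
Unset Strict Implicit.
Unset Printing Implicit Defensive.
Import Order.TTheory GRing.Theory Num.Theory.
Import numFieldNormedType.Exports.
Local Open Scope classical_set_scope.
Local Open Scope ring_scope.

(** An operator T : X -> Y lies in the dual ideal when T^* : Y^* -> X^* lies
    in A, and (T S)^* = S^* T^*.  So the whole point is to find finite rank
    operators S on X itself, rather than on X^*, for which S^* T^* is close to
    T^* in the norm of A ([approximation_by_adjoints]).

    The approximation property gives finite rank operators sum_i f_i (x) x_i^*
    close to T^*, where f_i is any functional on Y^*.  If each f_i had the form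
    T^{**} z_i with z_i in X, this sum would be S^* T^* for
    S = sum_i x_i^* (x) z_i.  The f_i must therefore be replaced by functionals
    of this form without a large change in norm, and for this T^* is first
    factored.  Since it is an A-limit of finite rank operators, it can be
    written as J U, where J : G -> X^* is injective and still in A, and U is an
    operator-norm limit of finite rank operators
    ([injective_approximable_factorization]).  Surjectivity of A enters here:
    the factorization produces an operator V in A, and passing to its range
    with the quotient norm makes it injective without leaving A.  Now
    approximate J, instead of T^*, by a finite rank operator
    sum_i h_i (x) x_i^*, so that T^* is approximated by
    sum_i (h_i U) (x) x_i^*.  The functionals h U are norm limits of functionals
    y |-> (J U y)(z) with z in X ([predual_pullback_dense]): by Hahn-Banach it
    suffices that a functional phi on the dual of the domain of U which kills
    the latter also kills h U; as U is a limit of finite rank operators,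
    U^{**} phi is a vector g of G; then J g vanishes on X, hence g = 0 and
    phi(h U) = h(g) = 0.

    Pointwise convergence then comes for free.  Given a finite rank P which
    fixes a finite set of points, replace S by S' with
    I - S' = (I - S)(I - P).  It fixes the same points, and
    T^* - S'^* T^* = (I - P)^* (I - S)^* T^* is small as soon as S is chosen
    after P ([approximation_fixing_finitely_many]).  The net is indexed by
    finite sets of points together with a tolerance.

    Hahn-Banach is obtained from minimal sublinear functionals, simultaneously
    for real and complex scalars. *)

(** * Real numbers as scalars, and real-valued norms *)

Section RealScalarsInK.
Context {R : realType} {k : scalar_kind}.
Notation K := (scalars R k).
Notation s := (@scalar_of_real R k).

Lemma scalar_of_realD a b : s (a + b) = s a + s b.
Proof. by rewrite /scalar_of_real; case: k => //=; rewrite rmorphD. Qed.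

Lemma scalar_of_realM a b : s (a * b) = s a * s b.
Proof. by rewrite /scalar_of_real; case: k => //=; rewrite rmorphM. Qed.

Lemma scalar_of_realN a : s (- a) = - s a.
Proof. by rewrite /scalar_of_real; case: k => //=; rewrite rmorphN. Qed.

Lemma scalar_of_realV a : s a^-1 = (s a)^-1.
Proof. by rewrite /scalar_of_real; case: k => //=; rewrite fmorphV. Qed.

Lemma ltr_scalar_of_real a b : (s a < s b) = (a < b).
Proof. by rewrite /scalar_of_real; case: k => //=; rewrite ltcR. Qed.

Lemma scalar_of_real_ge0 a : (0 <= s a) = (0 <= a).
Proof. by rewrite -(@scalar_of_real0 R k) ler_scalar_of_real. Qed.

Lemma scalar_of_real_gt0 a : (0 < s a) = (0 < a).
Proof. by rewrite -(@scalar_of_real0 R k) ltr_scalar_of_real. Qed.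

Lemma scalar_of_real_norm a : `|s a| = s `|a|.
Proof.
have [a0|a0] := leP 0 a; first by rewrite !ger0_norm// scalar_of_real_ge0.
rewrite !ler0_norm ?scalar_of_realN//; first exact: ltW.
by rewrite -(@scalar_of_real0 R k) ler_scalar_of_real ltW.
Qed.

Variable V : normedModType K.
Implicit Types x y : V.

Lemma rnormD x y : rnorm (x + y) <= rnorm x + rnorm y.
Proof. by rewrite -(@ler_scalar_of_real R k) scalar_of_realD !rnormE ler_normD. Qed.

Lemma rnorm_scalar (a : K) : rnorm (a : scalar_space R k) = real_part `|a|.
Proof. by []. Qed.

Lemma rnormZ (a : K) x : rnorm (a *: x) = real_part `|a| * rnorm x.
Proof.
apply: (can_inj (@scalar_of_realK R k)).
by rewrite scalar_of_realM ge0_real_partK// !rnormE normrZ.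
Qed.

Lemma rnormN x : rnorm (- x) = rnorm x.
Proof. by rewrite /rnorm normrN. Qed.

Lemma rnormB x y : rnorm (x - y) = rnorm (y - x).
Proof. by rewrite -opprB rnormN. Qed.

Lemma rnorm0 : rnorm (0 : V) = 0.
Proof. by apply: (can_inj (@scalar_of_realK R k)); rewrite rnormE normr0 scalar_of_real0. Qed.

Lemma rnorm_eq0 x : rnorm x = 0 -> x = 0.
Proof. by move=> x0; apply/normr0_eq0; rewrite -rnormE x0 scalar_of_real0. Qed.

Lemma rnorm_gt0 x : x != 0 -> 0 < rnorm x.
Proof.
by move=> x0; rewrite lt_neqAle rnorm_ge0 andbT eq_sym; apply: contra_neq x0 => /rnorm_eq0.
Qed.

Lemma real_part_scalar (t : R) : 0 <= t -> real_part `|s t| = t.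
Proof. by move=> t0; rewrite scalar_of_real_norm scalar_of_realK ger0_norm. Qed.
End RealScalarsInK.

(** * The Hahn-Banach theorem *)

Section HahnBanach.
Variables (R : realType) (k : scalar_kind).
Notation K := (scalars R k).
Notation s := (@scalar_of_real R k).
Variable V : lmodType K.

Definition sublinear (q : V -> R) :=
  (forall x y, q (x + y) <= q x + q y) /\
  (forall t x, 0 <= t -> q (s t *: x) = t * q x).

(** Every real-linear f <= q with f v = q v lies below slide q v.  If q is
    minimal then slide q v = q, and this is what makes q additive. *)
Definition slide (q : V -> R) (v x : V) : R :=
  inf [set q (x + s t *: v) - t * q v | t in [set t | 0 <= t]].

Lemma sublinear0 (q : V -> R) : sublinear q -> q 0 = 0.
Proof.
by move=> [_ /(_ 0 0 (lexx _))]; rewrite mul0r scaler0.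
Qed.

Lemma slide_lb (q : V -> R) (v : V) x t : sublinear q -> 0 <= t ->
  slide q v x <= q (x + s t *: v) - t * q v.
Proof.
move=> [qD qZ] t0; apply: ge_inf; last by exists t.
exists (- q (- x)) => _ [u /= u0 <-].
rewrite lerBrDl -qZ// lerBlDr (le_trans _ (qD _ _))//.
by rewrite addrAC subrr add0r.
Qed.

Lemma slide_has_inf (q : V -> R) (v : V) x : [set q (x + s t *: v) - t * q v | t in [set t | 0 <= t]] !=set0.
Proof. by exists (q (x + s 0 *: v) - 0 * q v), 0 => /=. Qed.

Lemma le_slide (q : V -> R) (v : V) x b : (forall t, 0 <= t -> b <= q (x + s t *: v) - t * q v) ->
  b <= slide q v x.
Proof.
by move=> qb; apply: lb_le_inf => [|_ [t /= t0 <-]]; [exact: slide_has_inf|exact: qb].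
Qed.

Lemma slide_le (q : V -> R) (v : V) x : sublinear q -> slide q v x <= q x.
Proof.
by move=> qs; have := slide_lb v x qs (lexx 0); rewrite scalar_of_real0 scale0r addr0 mul0r subr0.
Qed.

Lemma slide_sublinear (q : V -> R) (v : V) : sublinear q -> sublinear (slide q v).
Proof.
move=> qs; have [qD qZ] := qs; split=> [x y|t x t0].
  rewrite -lerBlDr; apply: le_slide => t t0.
  rewrite lerBlDr -lerBlDl; apply: le_slide => u u0.
  rewrite lerBlDl.
  apply: le_trans (slide_lb v (x + y) qs (addr_ge0 t0 u0)) _.
  rewrite scalar_of_realD scalerDl addrACA mulrDl.
  by have := qD (x + s t *: v) (y + s u *: v); lra.
have [->|tn0] := eqVneq t 0.
  rewrite scalar_of_real0 scale0r mul0r; apply/eqP; rewrite eq_le.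
  rewrite -{1}(sublinear0 qs) slide_le//=; apply: le_slide => u u0.
  by rewrite add0r qZ// subrr.
have tp : 0 < t by rewrite lt_neqAle eq_sym tn0.
apply/eqP; rewrite eq_le; apply/andP; split.
  rewrite -ler_pdivrMl//; apply: le_slide => u u0.
  rewrite ler_pdivrMl//; apply: le_trans (slide_lb v _ qs (mulr_ge0 t0 u0)) _.
  by rewrite scalar_of_realM -scalerA -scalerDr qZ// mulrBr mulrA.
apply: le_slide => u u0.
have u'0 : 0 <= t^-1 * u by rewrite mulr_ge0// invr_ge0.
apply: le_trans (ler_wpM2l t0 (slide_lb v x qs u'0)) _.
rewrite mulrBr -(qZ t)// scalerDr scalerA -scalar_of_realM !mulrA.
by rewrite divff// !mul1r.
Qed.

(** Zorn's lemma downwards: the sublinear functionals below p are bounded below by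
    - p (- x), so a chain has a pointwise infimum, and this infimum is
    sublinear because of any two members of the chain one is the smaller. *)
Lemma minimal_sublinear (p : V -> R) : sublinear p ->
  exists q, [/\ sublinear q, forall x, q x <= p x &
    forall q', sublinear q' -> (forall x, q' x <= q x) -> q' = q].
Proof.
move=> ps.
pose T := {q : V -> R | sublinear q /\ forall x, q x <= p x}.
pose le (q q' : T) := `[< forall x, sval q' x <= sval q x >].
have lb (q : T) x : - p (- x) <= sval q x.
  case: q => q [qs qp] /=; have := qs.1 x (- x); rewrite subrr (sublinear0 qs).
  by have := qp (- x); lra.
have [||||q qmin] := @Zorn T le.
- by move=> q; apply/asboolP.
- move=> a b c /asboolP ab /asboolP bc; apply/asboolP => x.
  exact: le_trans (bc x) (ab x).
- move=> [a aP] [b bP] /asboolP/= ab /asboolP/= ba; apply: eq_exist.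
  by apply/funext => x; apply/eqP; rewrite eq_le ab ba.
- move=> C Ctot; have [[q0 Cq0]|C0] := pselect (exists q, C q); last first.
    by exists (exist _ p (conj ps (fun x => lexx _))) => q Cq; case: C0; exists q.
  pose m x := inf [set sval q x | q in C].
  have mle q x : C q -> m x <= sval q x.
    move=> Cq; apply: ge_inf; last by exists q.
    by exists (- p (- x)) => _ [q' _ <-].
  have lem (b : R) x : (forall q, C q -> b <= sval q x) -> b <= m x.
    move=> Cb; apply: lb_le_inf; first by exists (sval q0 x), q0.
    by move=> _ [q Cq <-]; exact: Cb.
  have ms : sublinear m.
    split=> [x y|t x t0].
      rewrite -lerBlDr; apply: (lem _ _) => a Ca.
      rewrite lerBlDr -lerBlDl; apply: (lem _ _) => b Cb; rewrite lerBlDl.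
      have [/asboolP ab|/asboolP ba] := Ctot _ _ Ca Cb.
        by apply: le_trans (mle b _ Cb) _; apply: le_trans ((svalP b).1.1 _ _) _; rewrite lerD2r; exact: ab.
      by apply: le_trans (mle a _ Ca) _; apply: le_trans ((svalP a).1.1 _ _) _; rewrite lerD2l; exact: ba.
    have [->|tn0] := eqVneq t 0.
      rewrite scalar_of_real0 scale0r mul0r; apply/eqP; rewrite eq_le.
      rewrite -{1}(sublinear0 (svalP q0).1) mle//=; apply: (lem _ _) => q _.
      by rewrite (sublinear0 (svalP q).1).
    have tp : 0 < t by rewrite lt_neqAle eq_sym tn0.
    apply/eqP; rewrite eq_le; apply/andP; split.
      rewrite -ler_pdivrMl//; apply: (lem _ _) => q Cq; rewrite ler_pdivrMl//.
      by rewrite -(svalP q).1.2// mle.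
    by apply: (lem _ _) => q Cq; rewrite (svalP q).1.2// ler_wpM2l// mle.
  have mp : forall x, m x <= p x by move=> x; apply: le_trans (mle q0 x Cq0) ((svalP q0).2 x).
  by exists (exist _ m (conj ms mp)) => q Cq; apply/asboolP => x; exact: mle.
case: q qmin => q [qs qp] qmin; exists q; split=> // q' q's q'q.
have q'p x : q' x <= p x := le_trans (q'q x) (qp x).
have /= := qmin (exist _ q' (conj q's q'p)) (asboolT q'q).
by move=> /(congr1 sval).
Qed.

(** A minimal sublinear f below [slide p v] is linear.  Starting from
    [slide p v] rather than p also prescribes the value at v, because
    [slide p v (- v) <= - p v]. *)
Lemma real_hahn_banach (p : V -> R) (v : V) : sublinear p ->
  exists f : V -> R, [/\ forall x y, f (x + y) = f x + f y,
    forall t x, f (s t *: x) = t * f x, forall x, f x <= p x & f v = p v].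
Proof.
move=> ps; have [f [fs fp fmin]] := minimal_sublinear (slide_sublinear v ps).
have fD x y : f (x + y) = f x + f y.
  apply/eqP; rewrite eq_le fs.1/=.
  rewrite -{1}(fmin (slide f y) (slide_sublinear y fs) (fun z => slide_le y z fs)).
  rewrite -lerBrDr; apply: le_trans (slide_lb y x fs ler01) _.
  by rewrite scalar_of_real1 scale1r mul1r.
have fN x : f (- x) = - f x.
  by apply/eqP; rewrite -subr_eq0 opprK -fD addNr (sublinear0 fs).
exists f; split=> // [t x|x|].
- have [t0|t0] := leP 0 t; first exact: fs.2.
  by rewrite -[t]opprK scalar_of_realN scaleNr fN fs.2 ?oppr_ge0 ?mulNr// ltW.
- exact: le_trans (fp x) (slide_le v x ps).
apply/eqP; rewrite eq_le (le_trans (fp v) (slide_le v v ps))/=.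
rewrite -lerN2 -fN; apply: le_trans (fp _) _.
apply: le_trans (slide_lb v (- v) ps ler01) _.
by rewrite scalar_of_real1 scale1r addNr mul1r (sublinear0 ps) sub0r.
Qed.
End HahnBanach.

Section SeminormHahnBanach.
Variable R : realType.

Definition seminorm k (V : lmodType (scalars R k)) (p : V -> R) :=
  (forall x y, p (x + y) <= p x + p y) /\
  (forall a x, p (a *: x) = real_part `|a| * p x).

Lemma seminorm_sublinear k (V : lmodType (scalars R k)) (p : V -> R) :
  seminorm p -> sublinear p.
Proof. by move=> [pD pZ]; split=> // t x t0; rewrite pZ real_part_scalar. Qed.

Lemma seminorm_ge0 k (V : lmodType (scalars R k)) (p : V -> R) x :
  seminorm p -> 0 <= p x.
Proof.
move=> ps; have p0 := sublinear0 (seminorm_sublinear ps).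
have := ps.1 x (- x); rewrite subrr p0 -scaleN1r ps.2 normrN1.
rewrite -(@scalar_of_real1 R k) scalar_of_realK mul1r; lra.
Qed.

Lemma hahn_banach k (V : lmodType (scalars R k)) (p : V -> R) (v : V) :
  seminorm p -> exists f : V -> scalar_space R k, [/\ linear f,
    forall x, rnorm (f x) <= p x & f v = scalar_of_real (p v)].
Proof.
case: k V p v => V p v ps.
- have [f [fD fZ fp fv]] := real_hahn_banach v (seminorm_sublinear ps).
  exists f; split=> // [a x y|x]; first by rewrite fD [f (a *: x)]fZ.
  suff : `|f x| <= p x by [].
  have fN : - f x = f (- x) by rewrite -scaleN1r [RHS]fZ mulN1r.
  rewrite ler_norml lerNl fN fp andbT (le_trans (fp _))//.
  by rewrite -scaleN1r ps.2 normrN1 mul1r.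
have [f [fD fZ fp fv]] := real_hahn_banach v (seminorm_sublinear ps).
pose i : R[i] := 'i%C.
(* the complex functional with real part f *)
pose F x : R[i] := (f x +i* - f (i *: x))%C.
have Fadd x y : F (x + y) = F x + F y.
  by rewrite /F scalerDr !fD opprD; simpc.
have FZ (a : R[i]) x : F (a *: x) = a * F x.
  have aE : a = (complex.Re a)%:C%C + i * (complex.Im a)%:C%C.
    by case: a => a b; rewrite /i /=; simpc.
  have fE y : f (a *: y) = complex.Re a * f y + complex.Im a * f (i *: y).
    by rewrite {1}aE scalerDl fD fZ mulrC [i * _]mulrC -[_ *: y]scalerA fZ mulrC.
  have fii : f (i *: (i *: x)) = - f x.
    rewrite scalerA (_ : i * i = ((-1)%:C)%C) ?fZ ?mulN1r//.
    by rewrite /i; simpc.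
  rewrite /F fE scalerA [i * a]mulrC -scalerA fE fii.
  by case: (a) => b c /=; simpc; congr (_ +i* _)%C; ring.
have Fp x : complex.Re `|F x : R[i]| <= p x.
  have [->|Fx0] := eqVneq (F x) 0; first by rewrite normr0 seminorm_ge0.
  (* rotating x makes F x real, and then it is bounded by its real part f *)
  pose u : R[i] := `|F x| / F x.
  have u1 : `|u| = 1 by rewrite normrM normr_id normfV divff// normr_eq0.
  have <- : F (u *: x) = `|F x| by rewrite FZ divfK.
  by apply: le_trans (fp _) _; rewrite ps.2 u1 mul1r.
exists F; split=> [a x y|//|].
  by rewrite Fadd FZ.
have := Fp v; rewrite /F fv normc_def /= => Fle.
have pv0 : 0 <= p v := seminorm_ge0 v ps.
suff -> : f (i *: v) = 0 by rewrite oppr0.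
have := Fle; rewrite -[leRHS]ger0_norm// -sqrtr_sqr ler_sqrt ?sqr_ge0//.
rewrite gerDl sqrrN => h; apply/eqP; rewrite -sqrf_eq0 eq_le h sqr_ge0//.
Qed.
End SeminormHahnBanach.

(** * Operators and functionals *)

Section OperatorNorm.
Context {R : realType} {k : scalar_kind}.
Notation K := (scalars R k).
Notation s := (@scalar_of_real R k).
Variables X Y : normedModType K.

Lemma rnorm_bop (f : bop X Y) : rnorm f = opnorm f.
Proof. exact: scalar_of_realK. Qed.

Lemma opnormR_ge0 (f : bop X Y) : 0 <= opnorm f.
Proof. by rewrite -(@scalar_of_real_ge0 R k) opnorm_ge0. Qed.

Lemma le_opnorm (f : bop X Y) x : rnorm (f x) <= opnorm f * rnorm x.
Proof.
by rewrite -(@ler_scalar_of_real R k) scalar_of_realM !rnormE bop_norm_subproof.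
Qed.

Lemma opnorm_le (f : bop X Y) (M : R) : 0 <= M ->
  (forall x, rnorm (f x) <= M * rnorm x) -> opnorm f <= M.
Proof.
move=> M0 fM; rewrite -(@ler_scalar_of_real R k).
apply: bop_norm_le_subproof => [|x]; first by rewrite scalar_of_real_ge0.
by rewrite -!rnormE -scalar_of_realM ler_scalar_of_real.
Qed.

Lemma bounded_linear_rnorm (f : X -> Y) (M : R) : linear f ->
  (forall x, rnorm (f x) <= M * rnorm x) -> `[< bounded_linear f >].
Proof.
move=> fl fM; apply/asboolP; split=> //; exists (s M) => x.
by rewrite -!rnormE -scalar_of_realM ler_scalar_of_real.
Qed.

Lemma bop_addE (f g : bop X Y) x : (f + g) x = f x + g x.
Proof. by []. Qed.

Lemma bop_subE (f g : bop X Y) x : (f - g) x = f x - g x.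
Proof. by []. Qed.

Lemma bop_scaleE a (f : bop X Y) x : (a *: f) x = a *: f x.
Proof. by []. Qed.

Lemma bop_ext (f g : bop X Y) : f =1 g -> f = g.
Proof. by move=> fg; apply/val_inj/funext. Qed.

Lemma bop_sumE I (r : seq I) (P : pred I) (F : I -> bop X Y) x :
  (\sum_(i <- r | P i) F i) x = \sum_(i <- r | P i) F i x.
Proof. by apply: (big_ind2 (fun (f : bop X Y) y => f x = y)) => // f y g z <- <-. Qed.

End OperatorNorm.

Section OperatorAlgebra.
Context {R : realType} {k : scalar_kind}.
Notation K := (scalars R k).
Notation banach := (completeNormedModType K).

Lemma opnormD (X Y : banach) (f g : bop X Y) : opnorm (f + g) <= opnorm f + opnorm g.
Proof. by rewrite -!rnorm_bop rnormD. Qed.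

Lemma opnorm_subC (X Y : banach) (f g : bop X Y) : opnorm (f - g) = opnorm (g - f).
Proof. by rewrite -!rnorm_bop rnormB. Qed.

Lemma opnorm_id (X : banach) : opnorm (bop_id X) <= 1.
Proof. by apply: opnorm_le => // x; rewrite mul1r. Qed.

Lemma opnorm_comp (X Y Z : banach) (g : bop Y Z) (f : bop X Y) :
  opnorm (bop_comp g f) <= opnorm g * opnorm f.
Proof.
apply: opnorm_le => [|x]; first by rewrite mulr_ge0 ?opnormR_ge0.
apply: le_trans (le_opnorm g (f x)) _; rewrite -mulrA ler_wpM2l ?opnormR_ge0//.
exact: le_opnorm.
Qed.

End OperatorAlgebra.

Section DualSeparation.
Context {R : realType} {k : scalar_kind}.
Notation K := (scalars R k).
Notation s := (@scalar_of_real R k).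
Notation scal := (scalar_space R k).

Lemma functionalZ (V : normedModType K) (f : bop V scal) a x :
  (f (a *: x) : K) = a * (f x : K).
Proof. by rewrite linearZ. Qed.

Lemma functional_sum (V : normedModType K) (f : bop V scal) I (r : seq I)
    (P : pred I) (F : I -> V) :
  (f (\sum_(i <- r | P i) F i) : K) = \sum_(i <- r | P i) (f (F i) : K).
Proof. by rewrite linear_sum. Qed.

Lemma functionalB (V : normedModType K) (f : bop V scal) x y :
  (f (x - y) : K) = (f x : K) - (f y : K).
Proof. by rewrite linearB. Qed.

Lemma seminorm_le (V : lmodType K) (p : V -> R) :
  (forall x y, p (x + y) <= p x + p y) ->
  (forall a x, p (a *: x) <= real_part `|a| * p x) -> seminorm p.
Proof.
move=> pD pZ; split=> // a x; apply/eqP; rewrite eq_le pZ/=.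
have r0 : real_part (0 : K) = 0 by rewrite -(@scalar_of_real0 R k) scalar_of_realK.
have [->|a0] := eqVneq a 0.
  by rewrite normr0 r0 scale0r mul0r; have := pD 0 0; rewrite addr0; lra.
have ra : 0 < real_part `|a|.
  by rewrite -rnorm_scalar rnorm_gt0.
rewrite -ler_pdivlMl// -{1}[x](scalerK a0); apply: le_trans (pZ _ _) _.
rewrite normfV (_ : real_part `|a|^-1 = (real_part `|a|)^-1)//.
apply: (can_inj (@scalar_of_realK R k)).
by rewrite scalar_of_realV !ge0_real_partK// invr_ge0.
Qed.

Lemma norming_functional (V : normedModType K) (v : V) :
  exists f : bop V scal, opnorm f <= 1 /\ f v = s (rnorm v).
Proof.
have [|f [fl fp fv]] := @hahn_banach R k V (@rnorm R k V) v.
  by split=> [x y|a x]; [exact: rnormD|exact: rnormZ].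
have f1 x : rnorm (f x) <= 1 * rnorm x by rewrite mul1r.
exists (Bop (bounded_linear_rnorm fl f1)); split=> //.
exact: opnorm_le.
Qed.

Lemma separating_functional (V : normedModType K) (v : V) : v != 0 ->
  exists f : bop V scal, f v = 1.
Proof.
move=> v0; have [f [_ fv]] := norming_functional v.
have sv0 : s (rnorm v) != 0.
  by rewrite gt_eqF// scalar_of_real_gt0 rnorm_gt0.
by exists ((s (rnorm v))^-1 *: f); rewrite bop_scaleE fv; apply: mulVf.
Qed.

(** Hahn-Banach for the quotient seminorm x |-> inf_w |x - L w|, which vanishes
    on the range of L and at its limit points only. *)
Lemma range_dense (W : lmodType K) (V : normedModType K) (L : W -> V) (v : V) :
  linear L ->
  (forall f : bop V scal, (forall w, f (L w) = 0) -> f v = 0) ->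
  forall e : R, 0 < e -> exists w, rnorm (v - L w) < e.
Proof.
move=> Ll kill e e0.
pose Lm : {linear W -> V} := HB.pack L (GRing.isLinear.Build K W V _ L Ll).
have LD w u : L (w + u) = L w + L u := linearD Lm w u.
have LZ a w : L (a *: w) = a *: L w := linearZ_LR Lm a w.
have L0 : L 0 = 0 := linear0 Lm.
pose p x := inf [set rnorm (x - L w) | w in [set: W]].
have ple x w : p x <= rnorm (x - L w).
  apply: ge_inf; last by exists w.
  by exists 0 => _ [u _ <-]; exact: rnorm_ge0.
have lep (b : R) x : (forall w, b <= rnorm (x - L w)) -> b <= p x.
  move=> bx; apply: lb_le_inf => [|_ [w _ <-]//].
  by exists (rnorm (x - L 0)), 0.
have p0 x : 0 <= p x by apply: (lep) => w; exact: rnorm_ge0.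
have ps : seminorm p.
  apply: seminorm_le => [x y|a x].
    rewrite -lerBlDr; apply: (lep) => w.
    rewrite lerBlDr -lerBlDl; apply: (lep) => u; rewrite lerBlDl.
    apply: le_trans (ple _ (w + u)) _; rewrite LD opprD addrACA.
    exact: rnormD.
  have [->|a0] := eqVneq a 0.
    rewrite scale0r; apply: le_trans (ple _ 0) _.
    by rewrite L0 subrr rnorm0 mulr_ge0// -rnorm_scalar rnorm_ge0.
  have ra : 0 < real_part `|a| by rewrite -rnorm_scalar rnorm_gt0.
  rewrite -ler_pdivrMl//; apply: (lep) => w; rewrite ler_pdivrMl//.
  apply: le_trans (ple _ (a *: w)) _.
  by rewrite LZ -scalerBr rnormZ.
have [f [fl fp fv]] := hahn_banach v ps.
have f1 x : rnorm (f x) <= 1 * rnorm x.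
  rewrite mul1r; apply: le_trans (fp x) _; apply: le_trans (ple _ 0) _.
  by rewrite L0 subr0.
pose F : bop V scal := Bop (bounded_linear_rnorm fl f1).
have FL w : F (L w) = 0.
  apply: rnorm_eq0; apply/eqP; rewrite eq_le rnorm_ge0 andbT.
  apply: le_trans (fp _) _; apply: le_trans (ple _ w) _.
  by rewrite subrr rnorm0.
have pv : p v = 0.
  apply: (can_inj (@scalar_of_realK R k)).
  by rewrite -fv scalar_of_real0; exact: (kill F FL).
apply: contrapT => nw; suff : e <= p v by rewrite pv leNgt e0.
apply: (lep) => w; rewrite leNgt; apply/negP => we; apply: nw; by exists w.
Qed.
End DualSeparation.

(** * Finite rank operators *)

Section FiniteRank.
Context {R : realType} {k : scalar_kind}.
Notation K := (scalars R k).
Notation s := (@scalar_of_real R k).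
Notation scal := (scalar_space R k).
Notation banach := (completeNormedModType K).

Lemma rank_one_bounded (Y X : normedModType K) (f : bop Y scal) (x : X) :
  `[< bounded_linear (fun y : Y => (f y : K) *: x) >].
Proof.
apply: (@bounded_linear_rnorm R k Y X _ (opnorm f * rnorm x)) => [a u v|y].
  by rewrite linearP scalerDl scalerA.
by rewrite rnormZ mulrAC ler_wpM2r ?rnorm_ge0// -rnorm_scalar; exact: le_opnorm.
Qed.

Definition rank_one (Y X : normedModType K) (f : bop Y scal) (x : X) : bop Y X :=
  Bop (rank_one_bounded f x).

Lemma rank_oneE (Y X : normedModType K) (f : bop Y scal) (x : X) y :
  rank_one f x y = (f y : K) *: x.
Proof. by []. Qed.

Lemma opnorm_rank_one (Y X : normedModType K) (f : bop Y scal) (x : X) :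
  opnorm (rank_one f x) <= opnorm f * rnorm x.
Proof.
apply: opnorm_le => [|y]; first by rewrite mulr_ge0 ?rnorm_ge0 ?opnormR_ge0.
by rewrite rnormZ mulrAC ler_wpM2r ?rnorm_ge0// -rnorm_scalar; exact: le_opnorm.
Qed.

Definition tensor_sum (Y X : banach) (r : seq (dual Y * X)) : bop Y X :=
  \sum_(j <- r) rank_one j.1 j.2.

Lemma tensor_sumE (Y X : banach) (r : seq (dual Y * X)) y :
  tensor_sum r y = \sum_(j <- r) (j.1 y : K) *: j.2.
Proof. by rewrite bop_sumE. Qed.

Lemma finite_rank_tensor_sum (Y X : banach) (r : seq (dual Y * X)) :
  finite_rank (tensor_sum r).
Proof.
exists (size r), (fun i => (tnth (in_tuple r) i).2) => y.
exists (fun i => (tnth (in_tuple r) i).1 y).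
by rewrite tensor_sumE big_tnth.
Qed.

(** Restricting to the kernel of h removes one spanning vector: there the
    coefficient of e i is determined by the others. *)
Lemma span_ker_step (E : banach) (n : nat) (e : 'I_n.+1 -> E) (h : dual E)
    (i : 'I_n.+1) (c : 'I_n.+1 -> K) :
  h (e i) != 0 -> h (\sum_(j < n.+1) c j *: e j) = 0 ->
  \sum_(j < n.+1) c j *: e j =
  \sum_(j < n) c (lift i j) *:
    (e (lift i j) - ((h (e (lift i j)) : K) / (h (e i) : K)) *: e i).
Proof.
move=> hi0; rewrite !(bigD1_ord i)//= linearD linearZ linear_sum => /eqP.
rewrite addr_eq0 => /eqP/= hE.
under [RHS]eq_bigr do rewrite scalerBr.
rewrite big_split/= sumrN addrC; congr (_ + _).
under eq_bigr do rewrite scalerA mulrA.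
rewrite -scaler_suml -mulr_suml -scaleNr -mulNr; congr (_ *: _).
apply: (mulIf hi0); rewrite divfK//.
apply: etrans hE _; congr (- _); apply: eq_bigr => j _.
by rewrite linearZ.
Qed.

(** Induction on the number of vectors spanning the range: if h (T x0) = 1, then
    T - (h T) (x) T x0 maps into the kernel of h, and the removed term has a
    continuous coefficient.  Keeping all vectors in the range of T is what
    later transfers finite rank through injective operators. *)
Lemma finite_rank_factor (Y E : banach) (T : bop Y E) : finite_rank T ->
  exists r : seq (dual Y * Y),
    T = tensor_sum [seq (j.1, T j.2) | j <- r].
Proof.
move=> [n]; elim: n T => [|n IH] T [e Te].
  exists [::]; apply: bop_ext => y; rewrite tensor_sumE big_nil.
  by have [c ->] := Te y; rewrite big_ord0.
have [T0|] := pselect (forall y, T y = 0).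
  by exists [::]; apply: bop_ext => y; rewrite tensor_sumE big_nil T0.
move=> /existsNP[x0 /eqP Tx0].
have [h hx0] := separating_functional Tx0.
have [i hi] : exists i, h (e i) != 0.
  apply: contrapT => /forallNP he; have [c] := Te x0.
  move=> /(congr1 h); rewrite hx0 functional_sum big1 => [/eqP|i _].
    by rewrite oner_eq0.
  by rewrite functionalZ; have /negP := he i; rewrite negbK => /eqP ->; rewrite mulr0.
pose hT : dual Y := bop_comp h T.
pose T' := T - rank_one hT (T x0).
have T'E y : T' y = T (y - (hT y : K) *: x0).
  by rewrite linearB linearZ.
have hT' y : h (T' y) = 0.
  by rewrite bop_subE functionalB/= functionalZ hx0 mulr1 subrr.
have [|r T'r] := IH T'.
  exists (fun j => e (lift i j) - ((h (e (lift i j)) : K) / (h (e i) : K)) *: e i).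
  move=> y; have [c Tc] := Te (y - (hT y : K) *: x0).
  exists (fun j => c (lift i j)).
  by rewrite T'E Tc -span_ker_step// -Tc -T'E hT'.
exists ((hT, x0) :: [seq (j.1, j.2 - (hT j.2 : K) *: x0) | j <- r]).
rewrite /tensor_sum/= big_cons/= -[LHS](subrK (rank_one hT (T x0))) addrC.
rewrite -/T' {1}T'r /tensor_sum !big_map; congr (_ + _).
by apply: eq_bigr => j _; rewrite T'E.
Qed.

Lemma finite_rankP (Y E : banach) (T : bop Y E) :
  finite_rank T <-> exists r, T = tensor_sum r.
Proof.
split=> [/finite_rank_factor[r ->]|[r ->]]; last exact: finite_rank_tensor_sum.
by eexists.
Qed.

Lemma finite_rank_rank_one (Y X : banach) (f : dual Y) (x : X) :
  finite_rank (rank_one f x).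
Proof.
by apply/finite_rankP; exists [:: (f, x)]; rewrite /tensor_sum big_seq1.
Qed.

Lemma finite_rankD (Y X : banach) (S T : bop Y X) :
  finite_rank S -> finite_rank T -> finite_rank (S + T).
Proof.
move=> /finite_rankP[r ->] /finite_rankP[q ->]; apply/finite_rankP.
by exists (r ++ q); rewrite /tensor_sum big_cat.
Qed.

Lemma finite_rank_sum (Y X : banach) I (r : seq I) (T : I -> bop Y X) :
  (forall i, finite_rank (T i)) -> finite_rank (\sum_(i <- r) T i).
Proof.
move=> Tf; apply: (big_ind (@finite_rank R k Y X)) => [|S S' | i _].
- by apply/finite_rankP; exists [::]; rewrite /tensor_sum big_nil.
- exact: finite_rankD.
- exact: Tf.
Qed.

Lemma finite_rank_comp (W X Y Z : banach) (P : bop Y Z) (T : bop X Y) (S : bop W X) :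
  finite_rank T -> finite_rank (bop_comp P (bop_comp T S)).
Proof.
move=> [n [y Ty]]; exists n, (P \o y) => x.
have [c cx] := Ty (S x); exists c; rewrite /= cx linear_sum.
by apply: eq_bigr => i _; rewrite linearZ.
Qed.

Lemma finite_rankZ (Y X : banach) a (T : bop Y X) : finite_rank T -> finite_rank (a *: T).
Proof.
move=> [n [y Ty]]; exists n, y => x.
have [c cx] := Ty x; exists (fun i => a * c i); rewrite bop_scaleE cx scaler_sumr.
by apply: eq_bigr => i _; rewrite scalerA.
Qed.

(** The points are added one at a time: each new one is corrected by a rank
    one term that vanishes at the points already fixed by P. *)
Lemma finite_rank_fixing (X : banach) (xs : seq X) :
  exists2 P : bop X X, finite_rank P & forall x, x \in xs -> P x = x.
Proof.
elim: xs => [|v xs [P Pf Px]].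
  by exists 0 => //; apply/finite_rankP; exists [::]; rewrite /tensor_sum big_nil.
have [Pv|] := eqVneq (v - P v) 0.
  exists P => // x; rewrite inE => /predU1P[->|/Px//].
  by apply/esym/subr0_eq.
move=> /separating_functional[f fv].
(* id - P' = (id - f (x) (v - P v)) (id - P) *)
pose g : dual X := f - bop_comp f P.
exists (P + rank_one g (v - P v)).
  exact/finite_rankD/finite_rank_rank_one.
have gE x : g x = f (x - P x) by rewrite linearB.
move=> x; rewrite inE bop_addE rank_oneE gE => /predU1P[->|/Px xP].
  by rewrite fv scale1r addrC subrK.
by rewrite xP subrr linear0 scale0r addr0.
Qed.

Lemma finite_rankB (Y X : banach) (S T : bop Y X) :
  finite_rank S -> finite_rank T -> finite_rank (S - T).
Proof.
move=> Sf Tf; rewrite -scaleN1r; apply: finite_rankD => //.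
exact: finite_rankZ.
Qed.

Lemma finite_rank_inj (Y G E : banach) (J : bop G E) (W : bop Y G) :
  injective J -> finite_rank (bop_comp J W) -> finite_rank W.
Proof.
move=> Ji /finite_rank_factor[r JW].
suff -> : W = tensor_sum [seq (j.1, W j.2) | j <- r].
  exact: finite_rank_tensor_sum.
apply: bop_ext => y; apply: Ji; rewrite -[LHS]/(bop_comp J W y) JW.
rewrite !tensor_sumE !big_map linear_sum; apply: eq_bigr => j _.
by rewrite linearZ.
Qed.

Lemma rank_oneB (Y X : banach) (f g : dual Y) (x : X) :
  rank_one f x - rank_one g x = rank_one (f - g) x.
Proof. by apply: bop_ext => y; rewrite bop_subE !rank_oneE -scalerBl. Qed.

Definition approximable (Y X : banach) (T : bop Y X) :=
  forall e : R, 0 < e -> exists2 W : bop Y X, finite_rank W & opnorm (T - W) < e.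

End FiniteRank.

(** * Completeness through rapidly converging sequences *)

Section CompletenessBySequences.
Context {R : realType} {k : scalar_kind}.
Notation K := (scalars R k).
Notation s := (@scalar_of_real R k).

Lemma half_expn_lt (e : R) : 0 < e -> exists N, forall n, (N <= n)%N -> 2^-1 ^+ n < e.
Proof.
move=> e0; exists (Num.bound e^-1) => n Nn.
rewrite exprVn invf_plt ?posrE ?exprn_gt0//.
apply: lt_trans (archi_boundP _) _; first by rewrite invr_ge0 ltW.
by rewrite -natrX ltr_nat (leq_ltn_trans Nn)// ltn_expl.
Qed.

Lemma half_expn_gt0 n : 0 < 2^-1 ^+ n :> R.
Proof. by rewrite exprn_gt0// invr_gt0. Qed.

Lemma half_expnS n : 2^-1 ^+ n.+1 = 2^-1 ^+ n / 2 :> R.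
Proof. by rewrite exprSr. Qed.

(** Stated for an abstract distance because it serves both for norms of spaces
    and for ideal norms. *)
Lemma geometric_dist (d : nat -> nat -> R) N :
  (forall n, d n n = 0) -> (forall m n p, d m p <= d m n + d n p) ->
  (forall n, (N <= n)%N -> d n.+1 n <= 2 * 2^-1 ^+ n) ->
  forall m n, (N <= n)%N -> (n <= m)%N -> d m n <= 4 * 2^-1 ^+ n.
Proof.
move=> d0 dD dS m n Nn /subnKC<-; move: (m - n)%N => {m} p.
suff : d (n + p)%N n <= 4 * 2^-1 ^+ n - 4 * 2^-1 ^+ (n + p).
  by have := half_expn_gt0 (n + p); lra.
elim: p => [|p IH]; first by rewrite addn0 d0 subrr.
rewrite addnS; apply: le_trans (dD _ (n + p)%N _) _.
by have := dS (n + p)%N (leq_trans Nn (leq_addr _ _)); rewrite half_expnS; lra.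
Qed.

Lemma geometric_cauchy (V : normedModType K) (w : nat -> V) :
  (forall n, rnorm (w n.+1 - w n) <= 2 * 2^-1 ^+ n) ->
  forall m n, (n <= m)%N -> rnorm (w m - w n) <= 4 * 2^-1 ^+ n.
Proof.
move=> wS m n; apply: (geometric_dist (d := fun m n => rnorm (w m - w n)) (N := 0)) => //.
- by move=> i; rewrite subrr rnorm0.
- by move=> i j l; rewrite -(subrKA (w j)) rnormD.
Qed.

Lemma complete_seq (Z : completeNormedModType K) (u : nat -> Z) :
  (forall e : R, 0 < e -> exists N, forall m n, (N <= n)%N -> (n <= m)%N ->
     rnorm (u m - u n) < e) ->
  exists l, forall e : R, 0 < e -> exists N, forall n, (N <= n)%N ->
     rnorm (l - u n) < e.
Proof.
move=> uC.
have : cvg (u @ \oo).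
  apply: cauchy_cvg; apply/cauchyP => e e0.
  have [|N uN] := uC (real_part e).
    by rewrite -(@ltr_scalar_of_real R k) scalar_of_real0 ge0_real_partK// ltW.
  exists (u N); exists N => //= n /= Nn; rewrite -ball_normE /= distrC.
  by rewrite -rnormE -[ltRHS]ge0_real_partK ?ltr_scalar_of_real ?uN// ltW.
move=> /cvg_ex[l ul]; exists l => e e0.
move/cvgrPdist_lt: ul => /(_ (s e)); rewrite scalar_of_real_gt0 => /(_ e0)[N _ uN].
by exists N => n /uN/=; rewrite -rnormE ltr_scalar_of_real.
Qed.

Lemma complete_by_geometric_seq (V : normedModType K) :
  (forall u : nat -> V, (forall n, rnorm (u n.+1 - u n) < 2 * 2^-1 ^+ n) ->
     exists l, forall e : R, 0 < e -> exists N, forall n, (N <= n)%N ->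
       rnorm (l - u n) < e) ->
  forall F : set_system V, ProperFilter F -> cauchy F -> cvg F.
Proof.
move=> Vseq F FF /(cauchyP F) Fc.
have /choice[u uF] : forall n : nat, exists x, F [set y | rnorm (x - y) < 2^-1 ^+ n].
  move=> n; have [|x Fx] := Fc (s (2^-1 ^+ n)).
    by rewrite scalar_of_real_gt0 half_expn_gt0.
  exists x; apply: filterS Fx => y; rewrite -ball_normE /=.
  by rewrite -rnormE ltr_scalar_of_real.
have [|l ul] := Vseq u.
  move=> n; have [y []] := filter_ex (filterI (uF n) (uF n.+1)).
  rewrite /= => uy uSy; rewrite -(subrKA y); apply: le_lt_trans (rnormD _ _) _.
  rewrite [rnorm (y - _)]rnormB; move: uSy; rewrite half_expnS.
  by have := half_expn_gt0 n; lra.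
apply/cvg_ex; exists l; apply/(@fcvgrPdist_lt _ V) => e e0.
have re0 : 0 < real_part e / 2.
  rewrite divr_gt0// -(@ltr_scalar_of_real R k) scalar_of_real0.
  by rewrite ge0_real_partK// ltW.
have [N lN] := ul _ re0; have [M eM] := half_expn_lt re0.
pose n := maxn N M; apply: filterS (uF n) => y /= uny.
rewrite -rnormE -[ltRHS]ge0_real_partK ?ltr_scalar_of_real; last exact: ltW.
rewrite -(subrKA (u n)); apply: le_lt_trans (rnormD _ _) _.
have := lN n (leq_maxl _ _); have := eM n (leq_maxr _ _).
lra.
Qed.
End CompletenessBySequences.

(** * The range of an operator with the quotient norm *)

Section RangeSpace.
Context {R : realType} {k : scalar_kind}.
Notation K := (scalars R k).
Notation s := (@scalar_of_real R k).
Notation banach := (completeNormedModType K).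
Variables (Z E : banach) (V : bop Z E).

(** The quotient of Z by the kernel of V, realized inside E: the class of z is
    the vector V z.  Injectivity of the induced operator into E is thus built
    in. *)
Record range_space := RangeElement {
  range_val : E; range_valP : `[< exists z, V z = range_val >] }.

HB.instance Definition _ := [isSub for range_val].
HB.instance Definition _ := [Choice of range_space by <:].

Lemma range_submod :
  subsemimod_closed (fun e : E => `[< exists z, V z = e >]).
Proof.
split; [split|].
- by apply/asboolP; exists 0; rewrite linear0.
- by move=> e f /asboolP[y <-] /asboolP[z <-]; apply/asboolP; exists (y + z); rewrite linearD.
- by move=> a f /asboolP[y <-]; apply/asboolP; exists (a *: y); rewrite linearZ.
Qed.

HB.instance Definition _ :=
  GRing.SubChoice_isSubLmodule.Build K E _ range_space range_submod.

Implicit Types g : range_space.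

Definition range_norm g : R := inf [set rnorm z | z in [set z | V z = range_val g]].

Lemma range_norm_lb g z : V z = range_val g -> range_norm g <= rnorm z.
Proof.
move=> zg; apply: ge_inf; last by exists z.
by exists 0 => _ [u _ <-]; exact: rnorm_ge0.
Qed.

Lemma le_range_norm g (b : R) :
  (forall z, V z = range_val g -> b <= rnorm z) -> b <= range_norm g.
Proof.
move=> bg; apply: lb_le_inf => [|_ [z /= zg <-]]; last exact: bg.
by have /asboolP[z zg] := range_valP g; exists (rnorm z), z.
Qed.

Lemma range_norm_lt g (b : R) : range_norm g < b ->
  exists2 z, V z = range_val g & rnorm z < b.
Proof.
move=> gb; apply: contrapT => nz; move: gb; apply/negP; rewrite -leNgt.
apply: le_range_norm => z zg; rewrite leNgt; apply/negP => zb.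
by apply: nz; exists z.
Qed.

Lemma range_norm_ge0 g : 0 <= range_norm g.
Proof. by apply: le_range_norm => z _; exact: rnorm_ge0. Qed.

Lemma range_normD f g : range_norm (f + g) <= range_norm f + range_norm g.
Proof.
rewrite -lerBlDr; apply: le_range_norm => z zf.
rewrite lerBlDr -lerBlDl; apply: le_range_norm => y yg; rewrite lerBlDl.
apply: le_trans (rnormD _ _); apply: range_norm_lb.
by rewrite linearD/= zf yg.
Qed.

Lemma range_normZ a g : range_norm (a *: g) = real_part `|a| * range_norm g.
Proof.
suff ps : seminorm (V := range_space) range_norm by rewrite ps.2.
apply: seminorm_le; first exact: range_normD.
move=> {a g} a g.
have [->|a0] := eqVneq a 0.
  rewrite scale0r; apply: (@le_trans _ _ (rnorm (0 : Z))).
    by apply: range_norm_lb; rewrite linear0.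
  by rewrite rnorm0 mulr_ge0 ?range_norm_ge0// -rnorm_scalar rnorm_ge0.
have ra : 0 < real_part `|a| by rewrite -rnorm_scalar rnorm_gt0.
rewrite -ler_pdivrMl//; apply: le_range_norm => z zg; rewrite ler_pdivrMl//.
by rewrite -rnormZ; apply: range_norm_lb; rewrite linearZ/= zg.
Qed.

Lemma range_val_norm g : rnorm (range_val g) <= opnorm V * range_norm g.
Proof.
have [V0|V0] := leP (opnorm V) 0.
  have /asboolP[z <-] := range_valP g.
  have V00 : opnorm V = 0 by apply/eqP; rewrite eq_le V0 opnormR_ge0.
  by apply: le_trans (le_opnorm _ _) _; rewrite V00 !mul0r.
rewrite -ler_pdivrMl//; apply: le_range_norm => z zg; rewrite ler_pdivrMl//.
by rewrite -zg; exact: le_opnorm.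
Qed.

Lemma range_normD_subproof f g :
  s (range_norm (f + g)) <= s (range_norm f) + s (range_norm g).
Proof. by rewrite -scalar_of_realD ler_scalar_of_real range_normD. Qed.

Lemma range_normZ_subproof (a : K) g : s (range_norm (a *: g)) = `|a| * s (range_norm g).
Proof. by rewrite range_normZ scalar_of_realM ge0_real_partK. Qed.

Lemma range_norm0_subproof g : s (range_norm g) = 0 -> g = 0.
Proof.
move=> g0; apply: val_inj => /=; apply: rnorm_eq0; apply/eqP.
rewrite eq_le rnorm_ge0 andbT.
apply: le_trans (range_val_norm g) _.
by rewrite (_ : range_norm g = 0) ?mulr0// -(@scalar_of_realK R k (range_norm g)) g0
  -(@scalar_of_real0 R k) scalar_of_realK.
Qed.

HB.instance Definition _ := Lmodule_isNormed.Build K range_space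
  range_normD_subproof range_normZ_subproof range_norm0_subproof.

Lemma rnorm_range g : rnorm g = range_norm g.
Proof. exact: scalar_of_realK. Qed.

Definition range_proj_fun (z : Z) : range_space :=
  RangeElement (asboolT (ex_intro (fun x => V x = V z) z erefl)).

Lemma range_proj_bounded : `[< bounded_linear range_proj_fun >].
Proof.
apply: (@bounded_linear_rnorm R k Z range_space _ 1) => [a u v|z].
  by apply: val_inj; rewrite /= linearP.
by rewrite mul1r rnorm_range; exact: range_norm_lb.
Qed.

(** The steps of a rapidly converging sequence lift to Z with comparable norms,
    so the sequence itself lifts, up to a translation, to a Cauchy sequence. *)
Lemma range_complete (F : set_system range_space) :
  ProperFilter F -> cauchy F -> cvg F.
Proof.
apply: complete_by_geometric_seq => u uS.
have /choice[z zu] : forall n, exists z, range_proj_fun z = u n.+1 - u n /\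
    rnorm z < 2 * 2^-1 ^+ n.
  move=> n; have := uS n; rewrite rnorm_range => /range_norm_lt[z zu zn].
  by exists z; split=> //; exact: val_inj.
pose w n := \sum_(i < n) z i.
have [|l wl] := @complete_seq R k Z w.
  move=> e e0; have [|N eN] := @half_expn_lt R (e / 4); first by rewrite divr_gt0.
  exists N => m n Nn nm; apply: le_lt_trans (@geometric_cauchy R k Z w _ m n nm) _.
    by move=> i; rewrite /w big_ord_recr/= addrAC subrr add0r ltW// (zu i).2.
  by have := eN n Nn; lra.
pose Q : bop Z range_space := Bop range_proj_bounded.
have Qle x : rnorm (Q x) <= rnorm x by rewrite rnorm_range; exact: range_norm_lb.
have QD x y : Q (x + y) = Q x + Q y := linearD Q x y.
have QB x y : Q (x - y) = Q x - Q y := linearB Q x y.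
have Qw n : Q (w n) = u n - u 0%N.
  elim: n => [|n IH]; first by rewrite /w big_ord0 linear0 subrr.
  have -> : w n.+1 = w n + z n by rewrite /w big_ord_recr.
  rewrite QD IH [X in _ + X](zu n).1 addrC.
  by rewrite addrA subrK.
exists (Q l + u 0%N) => e e0; have [N wN] := wl e e0; exists N => n Nn.
rewrite -addrA [_ - u n](_ : _ = - Q (w n)); last by rewrite Qw opprB.
by rewrite -QB; apply: le_lt_trans (Qle _) (wN n Nn).
Qed.

HB.instance Definition _ := Uniform_isComplete.Build range_space range_complete.

Definition range_proj : bop Z range_space := Bop range_proj_bounded.

Lemma range_incl_bounded : `[< bounded_linear range_val >].
Proof.
apply: (@bounded_linear_rnorm R k range_space E _ (opnorm V)) => [a u v//|g].
by rewrite rnorm_range; exact: range_val_norm.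
Qed.

Definition range_incl : bop range_space E := Bop range_incl_bounded.

Lemma range_incl_inj : injective range_incl.
Proof. exact: val_inj. Qed.

Lemma range_proj_metric_surjection : metric_surjection (range_proj : bop Z range_space).
Proof.
split=> g.
  by have /asboolP[z zg] := range_valP g; exists z; exact: val_inj.
rewrite rnorm_range; congr (inf [set rnorm z | z in _]).
apply/seteqP; split=> z /= => [zg|<-//]; exact: val_inj.
Qed.
End RangeSpace.

(** * Norm estimates in a Banach operator ideal *)

Section IdealNorm.
Context {R : realType} {k : scalar_kind}.
Notation K := (scalars R k).
Notation s := (@scalar_of_real R k).
Notation scal := (scalar_space R k).
Notation banach := (completeNormedModType K).
Variable A : ideal_data R k.
Hypothesis hA : banach_operator_ideal A.

Lemma ideal_normN (X Y : banach) (T : bop X Y) :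
  in_ideal A T -> ideal_norm A (- T) = ideal_norm A T.
Proof.
move=> AT; rewrite -scaleN1r (ideal_normZ hA)// normrN1.
by rewrite -(@scalar_of_real1 R k) scalar_of_realK mul1r.
Qed.

Lemma idealN (X Y : banach) (T : bop X Y) : in_ideal A T -> in_ideal A (- T).
Proof. by move=> AT; rewrite -scaleN1r; exact: (idealZ hA). Qed.

Lemma idealB (X Y : banach) (S T : bop X Y) :
  in_ideal A S -> in_ideal A T -> in_ideal A (S - T).
Proof. by move=> AS AT; apply: (idealD hA) => //; exact: idealN. Qed.

Lemma ideal_normB (X Y : banach) (S T : bop X Y) :
  in_ideal A S -> in_ideal A T ->
  ideal_norm A (S - T) <= ideal_norm A S + ideal_norm A T.
Proof.
move=> AS AT; rewrite -(ideal_normN AT).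
by apply: (ideal_normD hA) => //; exact: idealN.
Qed.

Lemma ideal_norm0 (X Y : banach) : ideal_norm A (0 : bop X Y) = 0.
Proof.
rewrite -(scale0r (0 : bop X Y)) (ideal_normZ hA)//; last exact: ideal0.
by rewrite normr0 -(@scalar_of_real0 R k) scalar_of_realK mul0r.
Qed.

Lemma ideal_norm_ge0 (X Y : banach) (T : bop X Y) :
  in_ideal A T -> 0 <= ideal_norm A T.
Proof.
move=> AT; have := ideal_normB AT AT; rewrite subrr ideal_norm0; lra.
Qed.

Lemma ideal_norm_small_eq0 (X Y : banach) (T : bop X Y) : in_ideal A T ->
  (forall e : R, 0 < e -> ideal_norm A T <= e) -> T = 0.
Proof.
move=> AT Te; apply: (ideal_norm_eq0 hA) => //.
apply/eqP; rewrite eq_le ideal_norm_ge0// andbT.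
by apply/ler_addgt0Pr => e e0; rewrite add0r; exact: Te.
Qed.

(** Limits in the ideal norm are unique; this avoids comparing the ideal norm
    with the operator norm. *)
Lemma ideal_norm_dist_eq (X Y : banach) (S T : bop X Y) :
  in_ideal A S -> in_ideal A T ->
  (forall e : R, 0 < e -> exists W, [/\ in_ideal A W,
     ideal_norm A (S - W) < e & ideal_norm A (T - W) < e]) -> S = T.
Proof.
move=> AS AT h; apply/subr0_eq; apply: ideal_norm_small_eq0 => [|e e0].
  exact: idealB.
have [|W [AW SW TW]] := h (e / 2); first by rewrite divr_gt0.
rewrite (_ : S - T = (S - W) - (T - W)); last by rewrite opprB subrKA.
apply: le_trans (ideal_normB _ _) _; [exact: idealB|exact: idealB|].
lra.
Qed.

Lemma ideal_sum (X Y : banach) I (r : seq I) (T : I -> bop X Y) :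
  (forall i, in_ideal A (T i)) -> in_ideal A (\sum_(i <- r) T i).
Proof.
move=> AT; apply: (big_ind (@in_ideal R k A X Y)) => [|S S' | i _].
- exact: ideal0.
- exact: (idealD hA).
- exact: AT.
Qed.

Lemma ideal_norm_sum (X Y : banach) I (r : seq I) (T : I -> bop X Y) :
  (forall i, in_ideal A (T i)) ->
  ideal_norm A (\sum_(i <- r) T i) <= \sum_(i <- r) ideal_norm A (T i).
Proof.
move=> AT; elim: r => [|i r IH]; first by rewrite !big_nil ideal_norm0.
rewrite !big_cons; apply: le_trans (ideal_normD hA _ _) _ => //.
  exact: ideal_sum.
by rewrite lerD2l.
Qed.

Lemma ideal_compl (X Y Z : banach) (P : bop Y Z) (T : bop X Y) :
  in_ideal A T -> in_ideal A (bop_comp P T).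
Proof.
move=> AT; rewrite (_ : bop_comp P T = bop_comp P (bop_comp T (bop_id X))).
  exact: (ideal_comp hA).
exact: bop_ext.
Qed.

Lemma ideal_norm_compl (X Y Z : banach) (P : bop Y Z) (T : bop X Y) :
  in_ideal A T -> ideal_norm A (bop_comp P T) <= opnorm P * ideal_norm A T.
Proof.
move=> AT; rewrite (_ : bop_comp P T = bop_comp P (bop_comp T (bop_id X))).
  apply: le_trans (ideal_norm_comp hA _ _ AT) _.
  rewrite -[leRHS]mulr1 ler_wpM2l ?opnorm_id//.
  by rewrite mulr_ge0 ?opnormR_ge0 ?ideal_norm_ge0.
exact: bop_ext.
Qed.

Lemma ideal_compr (W X Y : banach) (T : bop X Y) (S : bop W X) :
  in_ideal A T -> in_ideal A (bop_comp T S).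
Proof.
move=> AT; rewrite (_ : bop_comp T S = bop_comp (bop_id Y) (bop_comp T S)).
  exact: (ideal_comp hA).
exact: bop_ext.
Qed.

Lemma ideal_norm_compr (W X Y : banach) (T : bop X Y) (S : bop W X) :
  in_ideal A T -> ideal_norm A (bop_comp T S) <= ideal_norm A T * opnorm S.
Proof.
move=> AT; rewrite (_ : bop_comp T S = bop_comp (bop_id Y) (bop_comp T S)).
  apply: le_trans (ideal_norm_comp hA _ _ AT) _.
  rewrite ler_wpM2r ?opnormR_ge0// -[leRHS]mul1r.
  by rewrite ler_wpM2r ?opnorm_id// ideal_norm_ge0.
exact: bop_ext.
Qed.

Lemma rank_one_comp (Y X : banach) (f : dual Y) (x : X) :
  rank_one f x = bop_comp (rank_one (bop_id scal) x) (bop_comp (bop_id scal) f).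
Proof. exact: bop_ext. Qed.

Lemma ideal_rank_one (Y X : banach) (f : dual Y) (x : X) :
  in_ideal A (rank_one f x).
Proof. by rewrite rank_one_comp; apply: (ideal_comp hA); exact: ideal_scalar_id. Qed.

Lemma ideal_norm_rank_one (Y X : banach) (f : dual Y) (x : X) :
  ideal_norm A (rank_one f x) <= opnorm f * rnorm x.
Proof.
rewrite rank_one_comp.
apply: le_trans (ideal_norm_comp hA _ _ (ideal_scalar_id hA)) _.
rewrite (ideal_norm_scalar_id hA) mulr1 mulrC ler_wpM2l ?opnormR_ge0//.
apply: le_trans (opnorm_rank_one _ _) _.
by rewrite -[leRHS]mul1r ler_wpM2r ?rnorm_ge0 ?opnorm_id.
Qed.

Lemma ideal_finite_rank (Y X : banach) (T : bop Y X) :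
  finite_rank T -> in_ideal A T.
Proof.
by move=> /finite_rankP[r ->]; apply: ideal_sum => j; exact: ideal_rank_one.
Qed.
End IdealNorm.

(** * Bounded sequences of vectors *)

Section CoefficientSpace.
Context {R : realType} {k : scalar_kind}.
Notation K := (scalars R k).
Notation s := (@scalar_of_real R k).
Notation scal := (scalar_space R k).
Notation banach := (completeNormedModType K).

(** Finitely supported scalar sequences with the l^1 norm, encoded as
    polynomials.  Bounded operators from this space to a Banach space Y are
    the bounded sequences in Y, and operators into a complete space already
    form a Banach space. *)
Definition coef_space : Type := {poly K}.
HB.instance Definition _ := GRing.Lmodule.on coef_space.

Implicit Types p q : coef_space.

Definition coef_norm p : K := \sum_(i < size (p : {poly K})) `|(p : {poly K})`_i|.

Lemma big_coef (V : nmodType) (F : nat -> K -> V) p n :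
  (forall i, F i 0 = 0) -> (size (p : {poly K}) <= n)%N ->
  \sum_(i < n) F i ((p : {poly K})`_i) =
  \sum_(i < size (p : {poly K})) F i ((p : {poly K})`_i).
Proof.
move=> F0 pn; rewrite [RHS](big_ord_widen n (fun i => F i ((p : {poly K})`_i)))//.
rewrite [RHS]big_mkcond/=; apply: eq_bigr => i _.
by case: ltnP => // pi; rewrite nth_default.
Qed.

Lemma coef_normE p n : (size (p : {poly K}) <= n)%N ->
  coef_norm p = \sum_(i < n) `|(p : {poly K})`_i|.
Proof.
by move=> pn; rewrite (big_coef (F := fun _ c => `|c|))// => i; rewrite normr0.
Qed.

Lemma coef_normD p q : coef_norm (p + q) <= coef_norm p + coef_norm q.
Proof.
pose n := maxn (size (p : {poly K})) (size (q : {poly K})).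
rewrite (@coef_normE p n) ?leq_maxl// (@coef_normE q n) ?leq_maxr//.
rewrite (@coef_normE _ n) ?size_polyD//.
by rewrite -big_split/= ler_sum// => i _; rewrite coefD ler_normD.
Qed.

Lemma coef_normZ (a : K) p : coef_norm (a *: p) = `|a| * coef_norm p.
Proof.
rewrite (@coef_normE _ (size (p : {poly K}))) ?size_scale_leq//.
by rewrite mulr_sumr; apply: eq_bigr => i _; rewrite coefZ normrM.
Qed.

Lemma coef_norm0 p : coef_norm p = 0 -> p = 0.
Proof.
move=> /eqP; rewrite psumr_eq0// => /allP p0; apply/polyP => i; rewrite coef0.
have [ip|pi] := ltnP i (size (p : {poly K})); last by rewrite nth_default.
have := p0 (Ordinal ip) (mem_index_enum _) => /=; rewrite normr_eq0.
by move=> /eqP.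
Qed.

HB.instance Definition _ := Lmodule_isNormed.Build K coef_space
  coef_normD coef_normZ coef_norm0.

(** The functional on [coef_space] given by a sequence a in l^infinity. *)
Definition weigh (a : nat -> R) p : scal :=
  \sum_(i < size (p : {poly K})) (p : {poly K})`_i * s (a i).

Lemma weighE a p n : (size (p : {poly K}) <= n)%N ->
  weigh a p = \sum_(i < n) (p : {poly K})`_i * s (a i).
Proof.
by move=> pn; rewrite (big_coef (F := fun i c => c * s (a i)))// => i; rewrite mul0r.
Qed.

Lemma weigh_linear a : linear (weigh a).
Proof.
move=> c p q; pose n := maxn (size (p : {poly K})) (size (q : {poly K})).
rewrite (@weighE a p n) ?leq_maxl// (@weighE a q n) ?leq_maxr//.
rewrite (@weighE a _ n).
  rewrite scaler_sumr -big_split/=; apply: eq_bigr => i _.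
  by rewrite coefD coefZ mulrDl -mulrA.
apply: leq_trans (size_polyD _ _) _; rewrite geq_max leq_maxr andbT.
exact: leq_trans (size_scale_leq _ _) (leq_maxl _ _).
Qed.

Lemma weigh_norm a p (M : R) : (forall i, `|a i| <= M) ->
  rnorm (weigh a p) <= M * rnorm p.
Proof.
move=> aM; rewrite -(@ler_scalar_of_real R k) scalar_of_realM !rnormE.
apply: le_trans (ler_norm_sum _ _ _) _; rewrite [`|p|]/(coef_norm p) mulr_sumr.
apply: ler_sum => i _; rewrite normrM mulrC ler_wpM2r//.
by rewrite scalar_of_real_norm ler_scalar_of_real.
Qed.

Lemma weigh_bounded a : (exists M, forall i, `|a i| <= M) ->
  `[< bounded_linear (weigh a) >].
Proof.
move=> [M aM]; apply: (@bounded_linear_rnorm R k _ _ _ M).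
  exact: weigh_linear.
by move=> p; exact: weigh_norm.
Qed.

Lemma monomial_norm n : rnorm ('X^n : coef_space) = 1.
Proof.
apply: (can_inj (@scalar_of_realK R k)); rewrite rnormE scalar_of_real1.
rewrite -[LHS]/(coef_norm ('X^n : coef_space)) (@coef_normE _ n.+1) ?size_polyXn// big_ord_recr/=.
rewrite big1 ?add0r; first by rewrite coefXn eqxx normr1.
by move=> i _; rewrite coefXn ltn_eqF// normr0.
Qed.

Lemma weigh_monomial (a : nat -> R) n : weigh a 'X^n = s (a n) :> K.
Proof.
rewrite (@weighE _ _ n.+1) ?size_polyXn// big_ord_recr/=.
rewrite big1 ?add0r; first by rewrite coefXn eqxx mul1r.
by move=> i _; rewrite coefXn ltn_eqF// mul0r.
Qed.

End CoefficientSpace.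

Section VectorSequences.
Context {R : realType} {k : scalar_kind}.
Notation K := (scalars R k).
Notation s := (@scalar_of_real R k).
Notation scal := (scalar_space R k).
Notation banach := (completeNormedModType K).
Variables (S : normedModType K) (Y : banach).

Lemma spread_bounded (b : bop S scal) :
  `[< bounded_linear (fun y : Y => rank_one b y) >].
Proof.
apply: (@bounded_linear_rnorm R k Y (bop S Y) _ (opnorm b)) => [a u v|y].
  by apply: bop_ext => p; rewrite bop_addE bop_scaleE /= scalerDr !scalerA mulrC.
by rewrite rnorm_bop opnorm_rank_one.
Qed.

(** For S = [coef_space] and b given by a bounded sequence a, this sends y to
    the sequence of vectors (a_n y). *)
Definition spread (b : bop S scal) : bop Y (bop S Y) := Bop (spread_bounded b).

Lemma opnorm_spread b : opnorm (spread b) <= opnorm b.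
Proof.
apply: opnorm_le => [|y]; first exact: opnormR_ge0.
by rewrite rnorm_bop opnorm_rank_one.
Qed.

Lemma spreadB b c : spread (b - c) = spread b - spread c.
Proof.
apply: bop_ext => y; apply: bop_ext => p.
by rewrite !bop_subE /= scalerBl.
Qed.

Lemma spread_sum n (a : 'I_n -> K) (b : 'I_n -> bop S scal) y :
  spread (\sum_(i < n) a i *: b i) y = \sum_(i < n) a i *: spread (b i) y.
Proof.
apply: bop_ext => p; rewrite bop_sumE /= bop_sumE scaler_suml.
by apply: eq_bigr => i _; rewrite !bop_scaleE /= [RHS]scalerA.
Qed.

Lemma eval_at_bounded (p : S) : `[< bounded_linear (fun f : bop S Y => f p) >].
Proof.
apply: (@bounded_linear_rnorm R k (bop S Y) Y _ (rnorm p)) => [a u v//|f].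
by rewrite rnorm_bop mulrC; exact: le_opnorm.
Qed.

Definition eval_at (p : S) : bop (bop S Y) Y := Bop (eval_at_bounded p).

Lemma opnorm_eval_at p : opnorm (eval_at p) <= rnorm p.
Proof.
apply: opnorm_le => [|f]; first exact: rnorm_ge0.
by have := le_opnorm f p; rewrite -rnorm_bop mulrC.
Qed.

End VectorSequences.

Section Weights.
Context {R : realType} {k : scalar_kind}.
Notation K := (scalars R k).
Notation s := (@scalar_of_real R k).
Notation scal := (scalar_space R k).
Notation banach := (completeNormedModType K).
Notation c00 := (@coef_space R k).

Definition half_pow (i : nat) : R := 2^-1 ^+ i.
Definition half_trunc (N i : nat) : R := if (i < N)%N then half_pow i else 0.
Definition unit_weight (n i : nat) : R := (i == n)%:R.

Lemma half_le1 i : half_pow i <= 1.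
Proof. by rewrite /half_pow exprn_ile1// ?invr_ge0// invf_le1//; lra. Qed.

Lemma half_ge0 i : 0 <= half_pow i.
Proof. by rewrite ltW// half_expn_gt0. Qed.

Lemma half_bound : exists M, forall i, `|half_pow i| <= M.
Proof. by exists 1 => i; rewrite ger0_norm ?half_ge0// half_le1. Qed.

Lemma half_trunc_bound N : exists M, forall i, `|half_trunc N i| <= M.
Proof.
exists 1 => i; rewrite /half_trunc; case: ifP => _; last by rewrite normr0.
by rewrite ger0_norm ?half_ge0// half_le1.
Qed.

Lemma unit_weight_bound n : exists M, forall i, `|unit_weight n i| <= M.
Proof. by exists 1 => i; rewrite /unit_weight; case: eqP; rewrite ?normr0 ?normr1. Qed.

Definition weight_functional a (ab : exists M, forall i, `|a i| <= M) : bop c00 scal :=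
  Bop (weigh_bounded ab).

Lemma half_tail N :
  opnorm (weight_functional half_bound - weight_functional (half_trunc_bound N)) <= half_pow N.
Proof.
apply: opnorm_le => [|p]; first exact: half_ge0.
rewrite bop_subE /= (_ : weigh half_pow p - _ = weigh (fun i => half_pow i - half_trunc N i) p).
  apply: weigh_norm => i; rewrite /half_trunc; case: ltnP => iN.
    by rewrite subrr normr0 half_ge0.
  rewrite subr0 ger0_norm ?half_ge0// /half_pow; apply: ler_wiXn2l => //.
  by rewrite invf_le1//; lra.
rewrite /weigh -sumrB; apply: eq_bigr => i _.
by rewrite scalar_of_realD scalar_of_realN mulrBr.
Qed.

Lemma half_trunc_sum N : weight_functional (half_trunc_bound N) =
  \sum_(n < N) s (half_pow n) *: weight_functional (unit_weight_bound n).
Proof.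
apply: bop_ext => p; rewrite bop_sumE [LHS]/=.
under [RHS]eq_bigr do rewrite bop_scaleE /= /weigh scaler_sumr.
rewrite exchange_big/=; apply: eq_bigr => i _.
rewrite /half_trunc; case: ltnP => iN.
  rewrite (bigD1 (Ordinal iN))//= big1 => [|j jN].
    by rewrite /unit_weight eqxx addr0 scalar_of_real1 mulr1 [RHS]mulrC.
  rewrite /unit_weight; case: eqP => [ij|]; last first.
    by rewrite scalar_of_real0 mulr0 scaler0.
  by move: jN; rewrite -val_eqE /= ij eqxx.
rewrite scalar_of_real0 mulr0 big1// => j _.
rewrite /unit_weight gtn_eqF ?(leq_trans (ltn_ord j))//.
by rewrite scalar_of_real0 mulr0 scaler0.
Qed.
End Weights.

(** * Factorization through an approximable operator *)

Section Factorization.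
Context {R : realType} {k : scalar_kind}.
Notation K := (scalars R k).
Notation s := (@scalar_of_real R k).
Notation banach := (completeNormedModType K).
Notation c00 := (@coef_space R k).
Variable A : ideal_data R k.
Hypothesis hA : banach_operator_ideal A.
Hypothesis hS : surjective_ideal A.

(** Write T = sum_n F_n with F_n of finite rank and A-norm O(4^-n).  On the
    space Z of bounded sequences (y_n) in Y the operator
    V : (y_n) |-> sum_n 2^n F_n y_n converges in A, and T = V U0 with
    U0 y = (2^-n y)_n.  Let G be the range of V, with J : G -> E its inclusion
    and Q : Z -> G the quotient map.  Surjectivity puts J in A, because J Q = V.
    Finally Q U0 is the norm limit of its truncations, which involve finitely
    many coordinates; on the n-th coordinate J Q is the finite rank operator
    2^n F_n, and J is injective. *)
Lemma injective_approximable_factorization (Y E : banach) (T : bop Y E) :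
  in_ideal A T ->
  (forall e : R, 0 < e ->
     exists2 S : bop Y E, finite_rank S & ideal_norm A (T - S) < e) ->
  exists (G : banach) (J : bop G E) (U : bop Y G),
    [/\ in_ideal A J, injective J, T = bop_comp J U & approximable U].
Proof.
move=> AT Tf.
have /choice[f' f'P] : forall n, exists S : bop Y E,
    finite_rank S /\ ideal_norm A (T - S) < half_pow n.+1 * half_pow n.+1.
  move=> n; have [|S Sf ST] := Tf (half_pow n.+1 * half_pow n.+1).
    by rewrite mulr_gt0// half_expn_gt0.
  by exists S.
(* starting from 0 makes f a sequence of partial sums; the estimate on T - f n
   then holds for positive n only *)
pose f n := if n is m.+1 then f' m else 0.
have ff n : finite_rank (f n).
  case: n => [|n]; last by have [] := f'P n.
  by exists 0, (fun=> 0) => x; exists (fun=> 0); rewrite big_ord0.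
have fT n : (0 < n)%N -> ideal_norm A (T - f n) < half_pow n * half_pow n.
  by case: n => // n _; have [] := f'P n.
have Af n : in_ideal A (f n) by exact: ideal_finite_rank.
pose F n := f n.+1 - f n.
have Ff n : finite_rank (F n) by exact: finite_rankB.
have AF n : in_ideal A (F n) by exact: ideal_finite_rank.
have F_norm n : (0 < n)%N -> ideal_norm A (F n) <= 2 * half_pow n * half_pow n.
  move=> n0; rewrite /F (_ : _ - _ = (T - f n) - (T - f n.+1)); last first.
    by rewrite opprB [RHS]addrC subrKA.
  apply: le_trans (ideal_normB hA _ _) _; [exact: idealB|exact: idealB|].
  have := fT n n0; have := fT n.+1 isT; rewrite {1 2}/half_pow half_expnS -/(half_pow n).
  have : 0 <= half_pow n * half_pow n :> R by rewrite mulr_ge0// half_ge0.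
  lra.
have sh0 n : s (half_pow n) != 0.
  by rewrite gt_eqF// scalar_of_real_gt0 half_expn_gt0.
pose Z : banach := bop c00 Y.
(* z ('X^n) is the n-th vector of the sequence z *)
pose v n : bop Z E :=
  (s (half_pow n))^-1 *: bop_comp (F n) (eval_at Y ('X^n : c00)).
have Av n : in_ideal A (v n) by apply: (idealZ hA); exact: ideal_compr.
have v_norm n : (0 < n)%N -> ideal_norm A (v n) <= 2 * 2^-1 ^+ n.
  move=> n0; rewrite /v (ideal_normZ hA); last exact: ideal_compr.
  rewrite -scalar_of_realV real_part_scalar ?invr_ge0 ?half_ge0//.
  rewrite ler_pdivrMl ?half_expn_gt0// -/(half_pow n).
  apply: le_trans (ideal_norm_compr hA _ (AF n)) _.
  apply: (@le_trans _ _ (ideal_norm A (F n) * 1)).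
    rewrite ler_wpM2l ?ideal_norm_ge0//; apply: le_trans (opnorm_eval_at _ _) _.
    by rewrite monomial_norm.
  by rewrite mulr1 [leRHS]mulrC; exact: F_norm.
pose P N := \sum_(n < N) v n.
have AP N : in_ideal A (P N) by exact: ideal_sum.
have Pcauchy m n : (0 < n)%N -> (n <= m)%N ->
    ideal_norm A (P m - P n) <= 4 * 2^-1 ^+ n.
  apply: (geometric_dist (d := fun m n => ideal_norm A (P m - P n))) => [i|i j l|i i0].
  - by rewrite subrr ideal_norm0.
  - by rewrite -(subrKA (P j)); apply: (ideal_normD hA); exact: idealB.
  - by rewrite {1}/P big_ord_recr/= addrAC subrr add0r; exact: v_norm.
have [V AV PV] : exists2 V, in_ideal A V & forall e : R, 0 < e ->
    exists N, forall n, (N <= n)%N -> ideal_norm A (P n - V) < e.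
  apply: (ideal_complete hA) => // e e0.
  have [|N eN] := @half_expn_lt R (e / 4); first by rewrite divr_gt0.
  exists N.+1 => m n Nm Nn; have [nm|mn] := leqP n m.
    apply: le_lt_trans (Pcauchy _ _ _ nm) _; first exact: leq_trans Nn.
    by have := eN n (ltnW Nn); lra.
  rewrite -(ideal_normN hA) ?opprB; last exact: idealB.
  apply: le_lt_trans (Pcauchy _ _ _ (ltnW mn)) _; first exact: leq_trans Nm.
  by have := eN m (ltnW Nm); lra.
have PVc (B : bop Y Z) (e : R) : 0 < e -> exists N, forall n, (N <= n)%N ->
    ideal_norm A (bop_comp V B - bop_comp (P n) B) < e.
  move=> e0; have B1 : 0 < opnorm B + 1 by rewrite ltr_wpDl ?opnormR_ge0.
  have [|N PN] := PV (e / (opnorm B + 1)); first by rewrite divr_gt0.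
  exists N => n Nn.
  rewrite (_ : _ - _ = bop_comp (V - P n) B); last exact: bop_ext.
  have AVP : in_ideal A (V - P n) by exact: idealB.
  apply: le_lt_trans (ideal_norm_compr hA _ AVP) _.
  rewrite -(ideal_normN hA)// opprB.
  apply: (@le_lt_trans _ _ (ideal_norm A (P n - V) * (opnorm B + 1))).
    by rewrite ler_wpM2l ?lerDl ?ideal_norm_ge0//; exact: idealB.
  by rewrite -ltr_pdivlMr//; exact: PN.
have PE n z : P n z = \sum_(i < n) (s (half_pow i))^-1 *: F i (z ('X^i : c00)).
  by rewrite /P bop_sumE.
pose U0 : bop Y Z := spread Y (weight_functional half_bound).
have PU n : bop_comp (P n) U0 = f n.
  apply: bop_ext => y; rewrite /= PE.
  transitivity (\sum_(i < n) (f i.+1 y - f i y)).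
    apply: eq_bigr => i _.
    rewrite [U0 y _](_ : _ = s (half_pow i) *: y); last by rewrite /= weigh_monomial.
    by rewrite linearZ scalerA mulVf// scale1r.
  rewrite -(big_mkord xpredT (fun i => f i.+1 y - f i y)) telescope_sumr//.
  by rewrite subr0.
have TV : T = bop_comp V U0.
  apply: (ideal_norm_dist_eq hA) => // [|e e0]; first exact: ideal_compr.
  have [N VN] := PVc U0 e e0; have [M eM] := half_expn_lt e0.
  pose n := (maxn N M).+1; exists (f n); split=> //.
    apply: lt_trans (fT n isT) _.
    apply: le_lt_trans (eM n (leq_trans (leq_maxr _ _) (leqnSn _))).
    by rewrite ler_piMr ?half_ge0 ?half_le1.
  by rewrite -PU; apply: VN; exact: leq_trans (leq_maxl _ _) (leqnSn _).
pose iota n : bop Y Z := spread Y (weight_functional (unit_weight_bound n)).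
have Piota n N : (n < N)%N -> bop_comp (P N) (iota n) = (s (half_pow n))^-1 *: F n.
  move=> nN; apply: bop_ext => y; rewrite [LHS]/= PE (bigD1 (Ordinal nN))// -[nat_of_ord (Ordinal nN)]/n.
  have iotaE i : iota n y ('X^i : c00) = s (unit_weight n i) *: y.
    by rewrite /= weigh_monomial.
  rewrite iotaE /unit_weight eqxx scalar_of_real1 scale1r big1 => [|i iN]; first exact: addr0.
  rewrite iotaE /unit_weight (_ : (i == n :> nat) = false).
    by rewrite scalar_of_real0 scale0r linear0 scaler0.
  by apply/negbTE; move: iN; rewrite -val_eqE.
have Viota n : bop_comp V (iota n) = (s (half_pow n))^-1 *: F n.
  have AW : in_ideal A ((s (half_pow n))^-1 *: F n) by exact: (idealZ hA).
  apply: (ideal_norm_dist_eq hA) => // [|e e0]; first exact: ideal_compr.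
  have [N VN] := PVc (iota n) e e0; exists ((s (half_pow n))^-1 *: F n); split=> //.
    rewrite -(@Piota n (maxn N n.+1)) ?leq_maxr//; apply: VN; exact: leq_maxl.
  by rewrite subrr ideal_norm0.
pose Q := range_proj V; pose J := range_incl V.
exists (range_space V), J, (bop_comp Q U0); split.
- have QV : bop_comp J Q = V by exact: bop_ext.
  have := hS (T := J) (range_proj_metric_surjection V); rewrite -/Q QV.
  by move=> /(_ AV)[].
- exact: range_incl_inj.
- by rewrite TV; exact: bop_ext.
move=> e e0; have [N eN] := half_expn_lt e0.
exists (bop_comp Q (spread Y (weight_functional (half_trunc_bound N)))); last first.
  apply: le_lt_trans (eN N (leqnn _)); apply: opnorm_le => [|y].
    exact: half_ge0.
  have -> : (bop_comp Q U0 - bop_comp Q (spread Y (weight_functional (half_trunc_bound N)))) y =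
      Q (spread Y (weight_functional half_bound - weight_functional (half_trunc_bound N)) y).
    by rewrite spreadB [RHS]linearB.
  have Qle z : rnorm (Q z) <= rnorm z by rewrite rnorm_range; exact: range_norm_lb.
  apply: le_trans (Qle _) _; apply: le_trans (le_opnorm _ _) _.
  rewrite ler_wpM2r ?rnorm_ge0//; apply: le_trans (opnorm_spread _ _) _.
  exact: half_tail.
rewrite (_ : bop_comp _ _ = \sum_(n < N) s (half_pow n) *: bop_comp Q (iota n)).
  apply: finite_rank_sum => n; apply: finite_rankZ.
  apply: (finite_rank_inj (@range_incl_inj _ _ _ _ V)).
  rewrite (_ : bop_comp _ _ = bop_comp V (iota n)); last exact: bop_ext.
  by rewrite Viota; exact: finite_rankZ.
apply: bop_ext => y; rewrite half_trunc_sum bop_sumE.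
rewrite [LHS](_ : _ = Q (spread Y (\sum_(n < N) s (half_pow n) *: weight_functional (unit_weight_bound n)) y))//.
rewrite spread_sum linear_sum; apply: eq_bigr => n _.
by rewrite linearZ.
Qed.
End Factorization.

(** * Functionals on a dual space and approximable operators *)

Section Bidual.
Context {R : realType} {k : scalar_kind}.
Notation K := (scalars R k).
Notation s := (@scalar_of_real R k).
Notation scal := (scalar_space R k).
Notation banach := (completeNormedModType K).

Lemma functional_small (c : scal) (M : R) :
  (forall e : R, 0 < e -> rnorm c <= M * e) -> c = 0.
Proof.
move=> cM; apply: rnorm_eq0; apply/eqP; rewrite eq_le rnorm_ge0 andbT.
apply/ler_addgt0Pr => e e0; rewrite add0r.
have M1 : 0 < `|M| + 1 by rewrite ltr_wpDl.
apply: le_trans (cM (e / (`|M| + 1)) _) _; first by rewrite divr_gt0.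
rewrite mulrCA ler_piMr ?(ltW e0)// ler_pdivrMr// mul1r.
by apply: le_trans (ler_norm _) _; rewrite lerDl.
Qed.

Lemma bidual_finite_rank (Y G : banach) (W : bop Y G) (phi : bop (dual Y) scal) :
  finite_rank W -> exists g : G, forall h : dual G, phi (bop_comp h W) = h g.
Proof.
move=> /finite_rankP[r ->]; exists (\sum_(j <- r) (phi j.1 : K) *: j.2) => h.
have -> : (bop_comp h (tensor_sum r) : dual Y) = \sum_(j <- r) (h j.2 : K) *: (j.1 : dual Y).
  apply: bop_ext => y; rewrite bop_sumE [LHS]/= tensor_sumE functional_sum.
  by apply: eq_bigr => j _; rewrite functionalZ bop_scaleE [RHS]mulrC.
rewrite [LHS]functional_sum [RHS]functional_sum; apply: eq_bigr => j _.
by rewrite !functionalZ mulrC.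
Qed.

(** The second adjoint of an approximable operator takes its values in G, not
    only in the bidual of G: this is clear for finite rank operators, and the
    vectors g_n obtained for an approximating sequence are Cauchy, since
    functionals on G compute norms. *)
Lemma bidual_approximable (Y G : banach) (U : bop Y G) (phi : bop (dual Y) scal) :
  approximable U -> exists g : G, forall h : dual G, phi (bop_comp h U) = h g.
Proof.
move=> Ua.
have /choice[W WP] : forall n, exists W : bop Y G,
    finite_rank W /\ opnorm (U - W) < half_pow n.
  by move=> n; have [W Wf UW] := Ua _ (half_expn_gt0 n); exists W.
have /choice[g gP] : forall n, exists g : G, forall h : dual G, phi (bop_comp h (W n)) = h g.
  by move=> n; exact: bidual_finite_rank (WP n).1.
have compB (h : dual G) (S T : bop Y G) :
    bop_comp h S - bop_comp h T = bop_comp h (S - T) :> dual Y.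
  by apply: bop_ext => y; rewrite bop_subE /= linearB.
have phi_comp (h : dual G) (S : bop Y G) :
    rnorm (phi (bop_comp h S)) <= opnorm phi * (opnorm h * opnorm S).
  apply: le_trans (le_opnorm _ _) _; rewrite ler_wpM2l ?opnormR_ge0//.
  by rewrite rnorm_bop; exact: opnorm_comp.
have gB m n : rnorm (g m - g n) <= opnorm phi * (half_pow m + half_pow n).
  have [h [h1 hg]] := norming_functional (g m - g n).
  rewrite -(@scalar_of_realK R k (rnorm _)) -hg.
  have : rnorm (h (g m - g n)) <= opnorm phi * (half_pow m + half_pow n).
    have -> : h (g m - g n) = phi (bop_comp h (W m - W n)).
      by rewrite -compB functionalB functionalB !gP.
    apply: le_trans (phi_comp _ _) _; rewrite ler_wpM2l ?opnormR_ge0//.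
    rewrite -[leRHS]mul1r; apply: ler_pM; rewrite ?opnormR_ge0//.
    rewrite -(subrKA U); apply: le_trans (opnormD _ _) _.
    by rewrite opnorm_subC lerD// ltW// (WP _).2.
  rewrite hg rnorm_scalar real_part_scalar ?rnorm_ge0//.
  by rewrite scalar_of_realK.
have [|l gl] := @complete_seq R k G g.
  move=> e e0; have phi1 : 0 < opnorm phi + 1 by rewrite ltr_wpDl ?opnormR_ge0.
  have [|N eN] := @half_expn_lt R (e / 2 / (opnorm phi + 1)).
    by rewrite !divr_gt0.
  exists N => m n Nn nm; apply: le_lt_trans (gB m n) _.
  apply: (@le_lt_trans _ _ ((opnorm phi + 1) * (half_pow m + half_pow n))).
    by rewrite ler_wpM2r ?addr_ge0 ?half_ge0// lerDl.
  have := eN n Nn; have := eN m (leq_trans Nn nm).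
  rewrite !ltr_pdivlMr// -/(half_pow m) -/(half_pow n); lra.
exists l => h; apply/subr0_eq.
apply: (@functional_small _ (opnorm phi * opnorm h + opnorm h)) => e e0.
have [N lN] := gl e e0; have [M eM] := half_expn_lt e0.
pose n := maxn N M.
have -> : phi (bop_comp h U) - h l = phi (bop_comp h (U - W n)) - h (l - g n).
  by rewrite -compB functionalB functionalB gP opprB subrKA.
apply: le_trans (rnormD _ _) _; rewrite rnormN mulrDl; apply: lerD.
  apply: le_trans (phi_comp _ _) _; rewrite mulrA ler_wpM2l ?mulr_ge0 ?opnormR_ge0//.
  by apply: ltW; apply: lt_trans (WP n).2 (eM n (leq_maxr _ _)).
apply: le_trans (le_opnorm _ _) _; rewrite ler_wpM2l ?opnormR_ge0//.
by rewrite ltW// lN// leq_maxl.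
Qed.

(** The restriction of T^* to X, seen inside the bidual of X. *)
Definition predual_pullback (Y X : banach) (T : bop Y (dual X)) (z : X) : dual Y :=
  bop_comp (eval_at scal z) T.

(** Weak-star density of these functionals in the dual of G, which is what
    injectivity of J says, becomes norm density after composition with U. *)
Lemma predual_pullback_dense (Y G X : banach) (J : bop G (dual X)) (U : bop Y G)
    (h : dual G) (e : R) :
  injective J -> approximable U -> 0 < e ->
  exists z : X, opnorm (bop_comp h U - predual_pullback (bop_comp J U) z : dual Y) < e.
Proof.
move=> Ji Ua e0.
have [|||w hw] := @range_dense R k X (dual Y) (predual_pullback (bop_comp J U))
   (bop_comp h U) _ _ e.
- by move=> a u v; apply: bop_ext => y; rewrite /= linearP.
- move=> phi phi0; have [g gP] := bidual_approximable phi Ua.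
  suff g0 : g = 0 by rewrite gP g0 linear0.
  apply: Ji; rewrite linear0; apply: bop_ext => z.
  rewrite -[LHS]/(predual_pullback J z g) -gP.
  rewrite (_ : bop_comp _ U = predual_pullback (bop_comp J U) z); last exact: bop_ext.
  exact: phi0 z.
- by [].
by exists w; rewrite -rnorm_bop.
Qed.
End Bidual.

(** * Approximation by adjoints of finite rank operators *)

Section ApproximationByAdjoints.
Context {R : realType} {k : scalar_kind}.
Notation K := (scalars R k).
Notation s := (@scalar_of_real R k).
Notation scal := (scalar_space R k).
Notation banach := (completeNormedModType K).
Variable A : ideal_data R k.
Hypothesis hA : banach_operator_ideal A.
Hypothesis hS : surjective_ideal A.

(** The approximation property is used twice: for T, to factor it as J U, and
    then for J. *)
Lemma approximation_by_adjoints (Y X : banach) (T : bop Y (dual X)) (e : R) :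
  approximation_property A (dual X) -> in_ideal A T -> 0 < e ->
  exists2 S : bop X X, finite_rank S &
    ideal_norm A (T - bop_comp (adjoint S) T) < e.
Proof.
move=> AP AT e0.
have [G [J [U [AJ Ji TJU Ua]]]] :=
  injective_approximable_factorization hA hS AT (AP _ _ AT).
have U1 : 0 < opnorm U + 1 by rewrite ltr_wpDl ?opnormR_ge0.
have [|F /finite_rankP[r Fr] JF] := AP _ _ AJ (e / 2 / (opnorm U + 1)).
  by rewrite !divr_gt0.
pose d := e / 2 / ((size r).+1)%:R.
have d0 : 0 < d by rewrite !divr_gt0.
have /choice[z zP] : forall j : dual G * dual X, exists z : X,
    opnorm (bop_comp j.1 U - predual_pullback T z : dual Y) * rnorm j.2 <= d.
  move=> j; have j1 : 0 < rnorm j.2 + 1 by rewrite ltr_wpDl ?rnorm_ge0.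
  have [|z hz] := predual_pullback_dense j.1 (e := d / (rnorm j.2 + 1)) Ji Ua.
    by rewrite divr_gt0.
  exists z; rewrite TJU; move: hz; rewrite ltr_pdivlMr// => /ltW; apply: le_trans.
  by rewrite ler_wpM2l ?opnormR_ge0// lerDl.
pose S : bop X X := tensor_sum [seq (j.2, z j) | j <- r].
exists S; first exact: finite_rank_tensor_sum.
have FU : bop_comp F U = \sum_(j <- r) rank_one (bop_comp j.1 U) j.2.
  by apply: bop_ext => y; rewrite Fr /= tensor_sumE bop_sumE.
have ST : bop_comp (adjoint S) T = \sum_(j <- r) rank_one (predual_pullback T (z j)) j.2.
  apply: bop_ext => y; apply: bop_ext => x; rewrite !bop_sumE [LHS]/=.
  rewrite tensor_sumE big_map functional_sum; apply: eq_bigr => j _.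
  by rewrite functionalZ rank_oneE bop_scaleE [LHS]mulrC.
have AJF : in_ideal A (J - F).
  apply: idealB => //; apply: ideal_finite_rank => //.
  by rewrite Fr; exact: finite_rank_tensor_sum.
have -> : T - bop_comp (adjoint S) T = bop_comp (J - F) U +
    \sum_(j <- r) rank_one (bop_comp j.1 U - predual_pullback T (z j)) j.2.
  rewrite (eq_bigr (fun j => rank_one (bop_comp j.1 U) j.2 -
     rank_one (predual_pullback T (z j)) j.2)); last by move=> j _; rewrite rank_oneB.
  rewrite sumrB -FU -ST addrA; congr (_ - _); rewrite {1}TJU.
  by apply: bop_ext => y; apply/esym; exact: (subrK (F (U y)) (J (U y))).
have Ar j : in_ideal A (rank_one (bop_comp j.1 U - predual_pullback T (z j) : dual Y) j.2).
  exact: ideal_rank_one.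
apply: le_lt_trans (ideal_normD hA _ _) _; first exact: ideal_compr.
  exact: ideal_sum.
rewrite [ltRHS]splitr; apply: ltr_leD.
  apply: le_lt_trans (ideal_norm_compr hA _ AJF) _.
  apply: (@le_lt_trans _ _ (ideal_norm A (J - F) * (opnorm U + 1))).
    by rewrite ler_wpM2l ?lerDl ?ideal_norm_ge0.
  by rewrite -ltr_pdivlMr.
apply: le_trans (ideal_norm_sum hA _ Ar) _.
apply: (@le_trans _ _ (\sum_(j <- r) d)).
  by apply: ler_sum => j _; apply: le_trans (ideal_norm_rank_one hA _ _) (zP j).
rewrite big_const_seq count_predT iter_addr addr0 -[leLHS]mulr_natr /d.
rewrite [leLHS]mulrAC ler_pdivrMr// ler_wpM2l ?ler_nat//.
by rewrite ltW// divr_gt0.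
Qed.

(** The correction I - S' = (I - S)(I - P) costs only the factor |(I - P)^*|,
    which is known before S is chosen. *)
Lemma approximation_fixing_finitely_many (X Y : banach) (T : bop X Y)
    (xs : seq X) (e : R) :
  approximation_property A (dual X) -> in_ideal A (adjoint T) -> 0 < e ->
  exists S : bop X X, [/\ finite_rank S, forall x, x \in xs -> S x = x &
    ideal_norm A (adjoint (bop_comp T S)) <= ideal_norm A (adjoint T) + e].
Proof.
move=> AP AT e0; have [P Pf Px] := finite_rank_fixing xs.
pose C := adjoint (bop_id X - P).
have C1 : 0 < opnorm C + 1 by rewrite ltr_wpDl ?opnormR_ge0.
have [|S Sf ST] := approximation_by_adjoints (e := e / (opnorm C + 1)) AP AT.
  by rewrite divr_gt0.
(* id - S' = (id - S) (id - P) *)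
exists (S + P - bop_comp S P); split.
- apply: finite_rankB; first exact: finite_rankD.
  rewrite (_ : bop_comp S P = bop_comp S (bop_comp P (bop_id X))).
    exact: finite_rank_comp.
  exact: bop_ext.
- by move=> x /Px xP; rewrite bop_subE bop_addE /= xP addrAC subrr add0r.
pose D := adjoint T - bop_comp (adjoint S) (adjoint T).
have Sfin : in_ideal A (bop_comp (adjoint S) (adjoint T)) by exact: ideal_compl.
have AD : in_ideal A D by exact: idealB.
(* T^* - S'^* T^* = (id - P)^* (id - S)^* T^* *)
have -> : adjoint (bop_comp T (S + P - bop_comp S P)) = adjoint T - bop_comp C D.
  apply: bop_ext => g; apply: bop_ext => x.
  pose q : dual X := bop_comp g T.
  transitivity (q (S x + P x - S (P x))); first by [].
  transitivity (q x - (q (x - P x) - q (S (x - P x)))); last by [].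
  have -> : q (x - P x) - q (S (x - P x)) = q (x - P x - S (x - P x)).
    by rewrite [RHS]functionalB.
  have qB w : q x - q w = q (x - w) by rewrite [RHS]functionalB.
  have SB : S (x - P x) = S x - S (P x) := linearB S x (P x).
  rewrite qB SB !opprB; congr (q _).
  by rewrite [RHS]addrC -!addrA addNr addr0 [in RHS](addrC (- S _)).
apply: le_trans (ideal_normB hA AT (ideal_compl hA C AD)) _; rewrite lerD2l.
apply: le_trans (ideal_norm_compl hA C AD) _.
apply: (@le_trans _ _ ((opnorm C + 1) * ideal_norm A D)).
  by rewrite ler_wpM2r ?lerDl ?ideal_norm_ge0.
by rewrite mulrC -ler_pdivlMr// ltW.
Qed.
End ApproximationByAdjoints.

Theorem proposition3p7 (R : realType) (k : scalar_kind) (A : ideal_data R k)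
    (X : completeNormedModType (scalars R k)) :
  banach_operator_ideal A ->
  surjective_ideal A ->
  ideal_incl A (dual_ideal (dual_ideal A)) ->
  approximation_property A (dual X) ->
  weak_MAP X (dual_ideal A).
Proof.
move=> hA hS _ AP Y T AT.
pose le (i j : seq X * nat) := {subset i.1 <= j.1} /\ (i.2 <= j.2)%N.
have /choice[S SP] : forall i : seq X * nat, exists S : bop X X,
    [/\ finite_rank S, forall x, x \in i.1 -> S x = x &
     ideal_norm A (adjoint (bop_comp T S)) <=
     ideal_norm A (adjoint T) + half_pow i.2].
  by move=> i; apply: approximation_fixing_finitely_many => //; exact: half_expn_gt0.
exists (seq X * nat)%type, le, S; split.
- split; first by exists ([::], 0%N).
  + by move=> i; split.
  + move=> i j l [ij1 ij2] [jl1 jl2]; split; first by move=> x /ij1/jl1.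
    exact: leq_trans jl2.
  + move=> i j; exists (i.1 ++ j.1, maxn i.2 j.2).
    rewrite /le /= leq_maxl leq_maxr; split; split=> // x xi;
      by rewrite mem_cat xi ?orbT.
- by move=> i; have [] := SP i.
- move=> x B /nbhs_singleton Bx; exists ([:: x], 0%N) => i [xi _] /=.
  by have [_ -> //] := SP i; apply: xi; rewrite inE.
apply/lee_addgt0Pr => e e0; have [n en] := half_expn_lt e0.
apply: (@le_trans _ _ (ereal_sup
  [set (ideal_norm (dual_ideal A) (bop_comp T (S j)))%:E
    | j in [set j | le ([::], n) j]])).
  by apply: ereal_inf_lbound; exists ([::], n).
apply: ge_ereal_sup => _ [i [_ /= ni] <-].
rewrite -EFinD lee_fin; have [_ _ h] := SP i; apply: le_trans h _.
by rewrite lerD2l ltW// en.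
Qed.
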